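(* For every nonnegative integer $r$, there is no generalized bent function $f:\mathbb{Z}_3^3\to\mathbb{Z}_{5\cdot 11^r}$.
   Context: A function $f:G\to\mathbb{Z}_m$ on a finite abelian group $G$ is a generalized bent function if $\left|\sum_{x\in G}\zeta_m^{f(x)}\chi(x)\right|^2=|G|$ for every character $\chi$ of $G$, where $\zeta_m$ is a primitive $m$-th root of unity. *)

(* Defs.v *)
From mathcomp Require Import all_boot all_order all_algebra all_fingroup all_field all_character.

Set Implicit Arguments.
Unset Strict Implicit.
Unset Printing Implicit Defensive.

Import GRing.Theory Num.Theory.
Local Open Scope ring_scope.

(* The characters of the finite abelian group G are the linear characters of
   its additive group, with values in algC; this loses nothing, since
   characters of finite groups and roots of unity have algebraic values.
   'Z_m is the ring of integers modulo m only for 1 < m. *)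
Definition generalized_bent (G : finZmodType) (m : nat) (zeta : algC)
    (f : G -> 'Z_m) : Prop :=
  forall chi : 'CF([set: G]), chi \is a linear_char ->
    `|\sum_(x : G) zeta ^+ f x * chi x| ^+ 2 = #|G|%:R.

(* Main.v *)
(** Write [D = \sum_x zeta^(f x) x]; every character value [chi(D)] is a cyclotomic
    integer of order dividing 15P with P = 11^(r+1) and [|chi(D)|^2 = 27].  Since 3 has
    odd order modulo P and is a primitive root modulo 5, the automorphism rho that fixes
    the 3P-th roots of unity and maps xi (of order 5) to xi^3 induces a Frobenius map
    modulo [1 - w], w of order 3, so it preserves the valuations of chi(D) at the primes
    above 3.  Hence rho(chi(D))/chi(D) is a cyclotomic integer of modulus 1, and this
    forces chi(D) to be a power of xi times an element of Z[mu_3P].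

    Split D = \sum_(i < 5) xi^i D_i.  The above says that the five numbers chi(D_i) agree
    except at one index j(chi).  If j is constant, Fourier inversion makes all D_i but one
    vanish, and [|chi_1(D)|^2 = 27] contradicts [27^2 <> 27] modulo 11.  Otherwise,
    comparing two characters modulo [1 - w] shows that the sum over the trivial character
    is 3b up to a root of unity, with b in Z[mu_P] and [|b|^2 = 3].  The trace form and the
    augmentation modulo 11 force b to be, up to a root of unity and a sign, a sum of five
    distinct 11-th roots of unity, which is incompatible with b coming from 27 roots of
    unity distributed over five classes. *)

Require Import Defs.
From mathcomp Require Import all_boot all_order all_algebra all_fingroup all_field all_character.
From mathcomp Require Import ring zify.

Set Implicit Arguments.
Unset Strict Implicit.
Unset Printing Implicit Defensive.

Import Order.TTheory GRing.Theory Num.Theory.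
Local Open Scope ring_scope.

Local Notation pZtoC := (map_poly (intr : int -> algC)).

(** * Cyclotomic integers *)

(** The ring Z[mu_n], built by adding or subtracting one root of unity at a time, so that claims
    reduce to roots by induction. For [n = 0] every number qualifies, whence the positivity
    hypotheses below. *)
Inductive cycint (n : nat) : algC -> Prop :=
| cycint0 : cycint n 0
| cycintDroot x z : cycint n x -> z ^+ n = 1 -> cycint n (x + z)
| cycintBroot x z : cycint n x -> z ^+ n = 1 -> cycint n (x - z).

Lemma cycint_root n z : z ^+ n = 1 -> cycint n z.
Proof. by move=> zn; rewrite -[z]add0r; apply: cycintDroot => //; apply: cycint0. Qed.

Lemma cycint1 n : cycint n 1.
Proof. by apply: cycint_root; rewrite expr1n. Qed.

Lemma cycintD n x y : cycint n x -> cycint n y -> cycint n (x + y).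
Proof.
move=> Hx; elim=> [|{}y z _ IH zn|{}y z _ IH zn]; first by rewrite addr0.
- by rewrite addrA; apply: cycintDroot.
- by rewrite addrA; apply: cycintBroot.
Qed.

Lemma cycintN n x : cycint n x -> cycint n (- x).
Proof.
elim=> [|y z _ IH zn|y z _ IH zn]; first by rewrite oppr0; apply: cycint0.
- by rewrite opprD; apply: cycintBroot.
- by rewrite opprB addrC; apply: cycintDroot.
Qed.

Lemma cycintB n x y : cycint n x -> cycint n y -> cycint n (x - y).
Proof. by move=> Hx Hy; apply: cycintD => //; apply: cycintN. Qed.

Lemma cycintM_root n x z : cycint n x -> z ^+ n = 1 -> cycint n (z * x).
Proof.
move=> + zn; elim=> [|y w _ IH wn|y w _ IH wn]; first by rewrite mulr0; apply: cycint0.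
- by rewrite mulrDr; apply: cycintDroot => //; rewrite exprMn zn wn mulr1.
- by rewrite mulrBr; apply: cycintBroot => //; rewrite exprMn zn wn mulr1.
Qed.

Lemma cycintM n x y : cycint n x -> cycint n y -> cycint n (x * y).
Proof.
elim=> [|{}x z _ IH zn|{}x z _ IH zn] Hy; first by rewrite mul0r; apply: cycint0.
- by rewrite mulrDl; apply: cycintD; [apply: IH | apply: cycintM_root].
- by rewrite mulrBl; apply: cycintB; [apply: IH | apply: cycintM_root].
Qed.

Lemma cycintX n x k : cycint n x -> cycint n (x ^+ k).
Proof.
move=> Hx; elim: k => [|k IH]; first by rewrite expr0; apply: cycint1.
by rewrite exprS; apply: cycintM.
Qed.

Lemma cycint_sum n (I : Type) (s : seq I) (P : pred I) (F : I -> algC) :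
  (forall i, P i -> cycint n (F i)) -> cycint n (\sum_(i <- s | P i) F i).
Proof. by move=> HF; apply: big_ind => //; [apply: cycint0 | apply: cycintD]. Qed.

Lemma cycint_int n (c : int) : cycint n c%:~R.
Proof.
have H k : cycint n (k%:R).
  elim: k => [|k IH]; first by apply: cycint0.
  by rewrite -addn1 natrD; apply: cycintD => //; apply: cycint1.
by case: c => k; [apply: H | rewrite NegzE rmorphN; apply: cycintN; apply: H].
Qed.

Lemma cycint_dvd n m x : (n %| m)%N -> cycint n x -> cycint m x.
Proof.
move=> /dvdnP[k ->]; elim=> [|y z _ IH zn|y z _ IH zn]; first exact: cycint0.
- by apply: cycintDroot => //; rewrite mulnC exprM zn expr1n.
- by apply: cycintBroot => //; rewrite mulnC exprM zn expr1n.
Qed.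


Lemma unity_root_norm n (z : algC) : (0 < n)%N -> z ^+ n = 1 -> `|z| = 1.
Proof.
move=> n0 zn; apply/eqP; rewrite -(@pexpr_eq1 _ _ n) ?normr_ge0 //.
by rewrite -normrX zn normr1.
Qed.

Lemma unity_root_conj n (z : algC) : (0 < n)%N -> z ^+ n = 1 -> z^* = z^-1.
Proof.
by move=> n0 zn; rewrite invC_norm (unity_root_norm n0 zn) expr1n invr1 mul1r.
Qed.

Lemma unity_root_neq0 n (z : algC) : (0 < n)%N -> z ^+ n = 1 -> z != 0.
Proof. by move=> n0 zn; rewrite -normr_eq0 (unity_root_norm n0 zn) oner_neq0. Qed.

Lemma cycint_conj n x : (0 < n)%N -> cycint n x -> cycint n x^*.
Proof.
move=> n0; elim=> [|y z _ IH zn|y z _ IH zn]; first by rewrite rmorph0; apply: cycint0.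
- by rewrite rmorphD; apply: cycintDroot; rewrite // -rmorphXn zn rmorph1.
- by rewrite rmorphB; apply: cycintBroot; rewrite // -rmorphXn zn rmorph1.
Qed.

Lemma cycint_rmorph n (u : {rmorphism algC -> algC}) x :
  cycint n x -> cycint n (u x).
Proof.
elim=> [|y z _ IH zn|y z _ IH zn]; first by rewrite rmorph0; apply: cycint0.
- by rewrite rmorphD; apply: cycintDroot; rewrite // -rmorphXn zn rmorph1.
- by rewrite rmorphB; apply: cycintBroot; rewrite // -rmorphXn zn rmorph1.
Qed.

(** Conjugation inverts roots of unity, and inversion commutes with every field morphism. *)
Lemma cycint_rmorph_conj n (u : {rmorphism algC -> algC}) x :
  (0 < n)%N -> cycint n x -> u x^* = (u x)^*.
Proof.
move=> n0; have H z : z ^+ n = 1 -> u z^* = (u z)^*.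
  move=> zn; rewrite (unity_root_conj n0 zn) fmorphV.
  by rewrite (unity_root_conj n0) // -rmorphXn zn rmorph1.
elim=> [|y z _ IH zn|y z _ IH zn]; first by rewrite !rmorph0.
- by rewrite !rmorphD /= IH H.
- by rewrite !rmorphB /= IH H.
Qed.

Lemma cycint_normC_rmorph n (u : {rmorphism algC -> algC}) x :
  (0 < n)%N -> cycint n x -> `|u x| ^+ 2 = u (`|x| ^+ 2).
Proof.
by move=> n0 Hx; rewrite !normCK rmorphM /= (cycint_rmorph_conj u n0 Hx).
Qed.

Lemma cycint_rmorph_fix n (u : {rmorphism algC -> algC}) x :
  (forall z, z ^+ n = 1 -> u z = z) -> cycint n x -> u x = x.
Proof.
move=> Hu; elim=> [|y z _ IH zn|y z _ IH zn]; first by rewrite rmorph0.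
- by rewrite rmorphD /= IH Hu.
- by rewrite rmorphB /= IH Hu.
Qed.

Lemma cycint_Aint n x : (0 < n)%N -> cycint n x -> x \in Aint.
Proof.
move=> n0; elim=> [|y z _ IH zn|y z _ IH zn]; first exact: rpred0.
- by rewrite rpredD //; apply: Aint_unity_root n0 _; apply/unity_rootP.
- by rewrite rpredB //; apply: Aint_unity_root n0 _; apply/unity_rootP.
Qed.

(** The quotient [y] is rational and an algebraic integer, hence an integer. *)
Lemma cycint_dvd_int n (c d : int) y : (0 < n)%N -> d != 0 ->
  cycint n y -> c%:~R = d%:~R * y -> (d %| c)%Z.
Proof.
move=> n0 d0 Hy E.
have Ey : y = ratr (c%:~R / d%:~R).
  rewrite rmorphM fmorphV /= !ratr_int E mulrC mulKf // intr_eq0 //.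
have /intrP[k Ek] : y \in Num.int.
  apply: Cint_rat_Aint; first by rewrite Ey; apply: Crat_rat.
  exact: cycint_Aint Hy.
apply/dvdzP; exists k; apply: (@intr_inj algC).
by rewrite E Ek intrM mulrC.
Qed.

Lemma cycint_poly n z x : n.-primitive_root z -> cycint n x ->
  exists p : {poly int}, x = (pZtoC p).[z].
Proof.
move=> zp; elim=> [|y w _ [p ->] wn|y w _ [p ->] wn].
- by exists 0; rewrite rmorph0 horner0.
- have [i ->] := prim_rootP zp wn; exists (p + 'X^i).
  by rewrite rmorphD /= map_polyXn hornerD hornerXn.
- have [i ->] := prim_rootP zp wn; exists (p - 'X^i).
  by rewrite rmorphB /= map_polyXn hornerD hornerN hornerXn.
Qed.

(** * Norms and traces *)

(** The product polynomial [q] takes the value [N] at every primitive root. Its remainder [s] modulo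
    the cyclotomic polynomial has degree below [totient n] and takes the value [N] at [totient n]
    points, so it is the constant [N], and its coefficients are integers. *)
Lemma cyclotomic_norm_int n z (p : {poly int}) : n.-primitive_root z ->
  \prod_(k < n | coprime k n) (pZtoC p).[z ^+ k] \in Num.int.
Proof.
move=> zp; set N := \prod_(k < n | _) _.
pose q := \prod_(k < n | coprime k n) (p \Po 'X^k).
pose s := Pdiv.Ring.rmodp q 'Phi_n.
pose ks := [seq k : 'I_n <- enum 'I_n | coprime k n].
have root_Phi w : n.-primitive_root w -> (pZtoC 'Phi_n).[w] = 0.
  by move=> wp; rewrite (Cintr_Cyclotomic wp); apply/rootP; rewrite root_cyclotomic.
have q_val j : coprime j n -> (pZtoC q).[z ^+ j] = N.
  move=> cj; have zjp : n.-primitive_root (z ^+ j) by rewrite prim_root_exp_coprime.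
  rewrite rmorph_prod horner_prod /=.
  under eq_bigr => k _ do rewrite map_comp_poly /= map_polyXn horner_comp hornerXn.
  (* The j-th power map permutes the primitive roots: both products equal the cyclotomic
     polynomial. *)
  have /prod_XsubC_eq Hperm :
      \prod_(x <- [seq (z ^+ j) ^+ (k : 'I_n) | k <- ks]) ('X - x%:P) =
      \prod_(x <- [seq z ^+ (k : 'I_n) | k <- ks]) ('X - x%:P).
    rewrite !big_map !big_filter !big_enum_cond /=.
    by rewrite -/(cyclotomic _ n) -/(cyclotomic _ n) -!Cintr_Cyclotomic.
  transitivity (\prod_(x <- [seq (z ^+ j) ^+ (k : 'I_n) | k <- ks]) (pZtoC p).[x]).
    by rewrite !big_map !big_filter !big_enum_cond.
  by rewrite (perm_big _ Hperm) /= !big_map !big_filter !big_enum_cond.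
have s_val j : coprime j n -> (pZtoC s).[z ^+ j] = N.
  move=> cj; rewrite -(q_val _ cj).
  rewrite [in RHS](Pdiv.RingMonic.rdivp_eq (Cyclotomic_monic n) q) rmorphD rmorphM /=.
  by rewrite hornerD hornerM root_Phi ?prim_root_exp_coprime // mulr0 add0r.
have size_s : (size s <= totient n)%N.
  rewrite -ltnS -size_Cyclotomic Pdiv.Ring.ltn_rmodpN0 //.
  by rewrite monic_neq0 ?Cyclotomic_monic.
suff E : pZtoC s = N%:P.
  suff -> : N = (s`_0)%:~R by exact: intr_int.
  by rewrite -(coef_map (intr : int -> algC)) E coefC.
apply/eqP; rewrite -subr_eq0 -[_ == 0]negbK; apply/negP => nz.
pose rs := [seq z ^+ (k : 'I_n) | k <- ks].
have : (size rs < size (pZtoC s - N%:P)%R)%N.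
  apply: max_poly_roots nz _ _.
    apply/allP => _ /mapP[k + ->]; rewrite mem_filter => /andP[ck _].
    by rewrite /root hornerD hornerN hornerC s_val // subrr.
  rewrite map_inj_in_uniq; first exact/filter_uniq/enum_uniq.
  move=> i j _ _ /eqP.
  by rewrite (eq_prim_root_expr zp) !modn_small // => /eqP/val_inj.
have -> : size rs = totient n.
  rewrite size_map size_filter totient_count_coprime big_mkord -sum1_count big_enum_cond.
  by rewrite big_mkcond; apply: eq_bigr => i _; rewrite coprime_sym; case: coprime.
apply/negP; rewrite -leqNgt.
apply: leq_trans (size_polyD _ _) _; rewrite size_polyN geq_max size_polyC.
have t0 : (0 < totient n)%N by rewrite totient_gt0 (prim_order_gt0 zp).
apply/andP; split; first by rewrite size_map_inj_poly //; apply: intr_inj.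
by case: (N == 0).
Qed.

(** The k-th power map on n-th roots of unity, extended to [algC]. The default [idfun] makes it
    total in [k], so that it can stand under sums over [k]. *)
Definition galois_aut (n k : nat) : {rmorphism algC -> algC} :=
  (if coprime k n as b return coprime k n = b -> _
   then fun co => sval (Qn_aut_exists co) else fun=> idfun) erefl.

Lemma galois_autE n k z : coprime k n -> z ^+ n = 1 -> galois_aut n k z = z ^+ k.
Proof.
move=> co zn; rewrite /galois_aut; move: (erefl _) => e; move: {2 3}(coprime k n) e.
case=> [e|]; last by rewrite co.
by case: (Qn_aut_exists e) => u /= ->.
Qed.

Lemma card_coprime n : (0 < n)%N -> #|[pred k : 'I_n | coprime k n]| = totient n.
Proof.
move=> n0; rewrite totient_count_coprime big_mkord -sum1_card big_mkcond.
by apply: eq_bigr => i _; rewrite inE coprime_sym; case: coprime.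
Qed.

(* The norm is a nonzero integer, so the claim is the inequality of arithmetic
   and geometric means. *)
Lemma cycint_trace_ge n x : (0 < n)%N -> cycint n x -> x != 0 ->
  (totient n)%:R <= \sum_(k < n | coprime k n) `|galois_aut n k x| ^+ 2.
Proof.
move=> n0 Hx x0; have [z zp] := C_prim_root_exists n0.
have [p Ep] := cycint_poly zp Hx.
have aut_x k : coprime k n -> galois_aut n k x = (pZtoC p).[z ^+ k].
  move=> co; rewrite Ep -horner_map /= galois_autE ?(prim_expr_order zp) //.
  rewrite -map_poly_comp; congr (_.[_]); apply: eq_map_poly => c /=.
  by rewrite rmorph_int.
pose N := \prod_(k < n | coprime k n) galois_aut n k x.
have N_int : N \in Num.int.
  by rewrite /N (eq_bigr _ (fun k co => aut_x _ co)) cyclotomic_norm_int.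
have N_neq0 : N != 0 by rewrite prodf_seq_neq0; apply/allP => k _; rewrite fmorph_eq0 x0 implybT.
have N_ge1 : 1 <= \prod_(k < n | coprime k n) `|galois_aut n k x| ^+ 2.
  rewrite prodrXl -normr_prod -/N -[1](expr1n _ 2).
  by rewrite lerXn2r ?nnegrE ?normr_ge0 ?ler01 // norm_intr_ge1.
pose A := [pred k : 'I_n | coprime k n].
pose E (k : 'I_n) := `|galois_aut n k x| ^+ 2.
have E_ge0 : {in A, forall k, 0 <= E k} by move=> k _; rewrite exprn_ge0.
have {}AGM := le_trans N_ge1 (leif_AGM E_ge0).1.
rewrite card_coprime // in AGM.
set S := (X in _ <= X); have {}AGM : 1 <= (S / (totient n)%:R) ^+ totient n := AGM.
have t0 : (0 < totient n)%N by rewrite totient_gt0.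
have S0 : 0 <= S / (totient n)%:R.
  by rewrite divr_ge0 ?ler0n // sumr_ge0 // => k _; rewrite exprn_ge0.
have : 1 <= S / (totient n)%:R by rewrite -(expr_ge1 t0 S0).
by rewrite ler_pdivlMr ?ltr0n // mul1r.
Qed.

(** * Finite Fourier sums *)

Lemma sum_unity_root n (w : algC) : (0 < n)%N -> w ^+ n = 1 ->
  \sum_(t < n) w ^+ t = n%:R *+ (w == 1).
Proof.
move=> n0 wn; case: eqP => [->|/eqP w1].
  by under eq_bigr do rewrite expr1n; rewrite sumr_const card_ord mulr1n.
rewrite mulr0n; apply: (mulfI (x := w - 1)); first by rewrite subr_eq0.
by rewrite -subrX1 wn subrr mulr0.
Qed.

Lemma parseval n z (c : 'I_n -> algC) : n.-primitive_root z ->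
  \sum_(t < n) `|\sum_(j < n) z ^+ (t * j) * c j| ^+ 2 =
  n%:R * \sum_(j < n) `|c j| ^+ 2.
Proof.
move=> zp; have n0 := prim_order_gt0 zp; have zn := prim_expr_order zp.
have z0 := unity_root_neq0 n0 zn.
under eq_bigr => t _.
  rewrite normCK rmorph_sum mulr_suml.
  under eq_bigr => j _.
    rewrite mulr_sumr.
    under eq_bigr => k _.
      rewrite rmorphM rmorphXn /= (unity_root_conj n0 zn).
      rewrite mulrACA [(t * j)%N]mulnC [(t * k)%N]mulnC !exprM -exprMn.
      over.
    over.
  over.
rewrite exchange_big mulr_sumr; apply: eq_bigr => j _.
rewrite exchange_big (bigD1 j) //= [X in _ + X]big1 ?addr0 => [|k kj].
  rewrite -mulr_suml sum_unity_root //.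
    by rewrite exprVn divff ?expf_neq0 // eqxx mulr1n normCK.
  by rewrite exprVn divff ?expf_neq0 // expr1n.
rewrite -mulr_suml sum_unity_root //.
  case: eqP => [E|_]; last by rewrite mulr0n mul0r.
  case/eqP: kj; apply/val_inj/eqP.
  have : z ^+ k == z ^+ j.
    rewrite exprVn in E; apply/eqP.
    by rewrite -[LHS]mul1r -E mulfVK // expf_neq0.
  by rewrite (eq_prim_root_expr zp) !modn_small.
by rewrite exprMn exprVn exprAC zn expr1n mul1r exprVn exprAC zn expr1n invr1.
Qed.

(** * Divisibility and Frobenius congruences *)

Definition cycdvd n d x := exists2 y, cycint n y & x = d * y.

Lemma cycdvd0 n d : cycdvd n d 0.
Proof. by exists 0; rewrite ?mulr0 //; apply: cycint0. Qed.

Lemma cycdvdD n d x y : cycdvd n d x -> cycdvd n d y -> cycdvd n d (x + y).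
Proof.
move=> [x' Hx ->] [y' Hy ->]; exists (x' + y'); first exact: cycintD.
by rewrite mulrDr.
Qed.

Lemma cycdvdN n d x : cycdvd n d x -> cycdvd n d (- x).
Proof. by move=> [x' Hx ->]; exists (- x'); [apply: cycintN | rewrite mulrN]. Qed.

Lemma cycdvdB n d x y : cycdvd n d x -> cycdvd n d y -> cycdvd n d (x - y).
Proof. by move=> Hx Hy; apply: cycdvdD => //; apply: cycdvdN. Qed.

Lemma cycdvdMr n d x y : cycint n y -> cycdvd n d x -> cycdvd n d (x * y).
Proof. by move=> Hy [x' Hx ->]; exists (x' * y); [apply: cycintM | rewrite mulrA]. Qed.

Lemma cycdvdMl n d x y : cycint n y -> cycdvd n d x -> cycdvd n d (y * x).
Proof. by move=> Hy Hx; rewrite mulrC; apply: cycdvdMr. Qed.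

Lemma cycdvd_subXX n d x y k : cycint n x -> cycint n y ->
  cycdvd n d (x - y) -> cycdvd n d (x ^+ k - y ^+ k).
Proof.
move=> Hx Hy Hd; rewrite subrXX; apply: cycdvdMr => //.
by apply: cycint_sum => i _; apply: cycintM; apply: cycintX.
Qed.

Lemma cycint_frobD n p x y : prime p -> cycint n x -> cycint n y ->
  cycdvd n p%:R ((x + y) ^+ p - (x ^+ p + y ^+ p)).
Proof.
move=> pp Hx Hy; have p0 := prime_gt0 pp.
rewrite exprDn (bigD1 ord0) //= (bigD1 ord_max) /=; last by rewrite -val_eqE /= -lt0n.
rewrite subn0 subnn !expr0 bin0 binn mulr1 mul1r !mulr1n.
rewrite addrA [X in cycdvd _ _ X]addrAC subrr add0r.
apply: big_ind => [||i /andP[i0 iM]]; [exact: cycdvd0 | exact: cycdvdD |].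
have /dvdnP[c ->] : (p %| 'C(p, i))%N.
  apply: prime_dvd_bin => //; rewrite lt0n -(inj_eq val_inj) /= in i0 *.
  by rewrite i0 ltn_neqAle -ltnS ltn_ord andbT.
exists (x ^+ (p - i) * y ^+ i *+ c).
  rewrite -mulr_natr; apply: cycintM; first by apply: cycintM; apply: cycintX.
  exact: (cycint_int n c).
by rewrite mulrnA mulr_natl.
Qed.

Lemma cycint_frobD_iter n p N x y : prime p -> cycint n x -> cycint n y ->
  cycdvd n p%:R ((x + y) ^+ (p ^ N) - (x ^+ (p ^ N) + y ^+ (p ^ N))).
Proof.
move=> pp Hx Hy; elim: N => [|N IH].
  by rewrite expn0 !expr1 subrr; apply: cycdvd0.
rewrite expnSr !exprM.
have -> (a b c : algC) : a ^+ p - (b ^+ p + c ^+ p) =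
   (a ^+ p - (b + c) ^+ p) + ((b + c) ^+ p - (b ^+ p + c ^+ p)).
  by rewrite addrA subrK.
apply: cycdvdD; last by apply: cycint_frobD => //; apply: cycintX.
by apply: cycdvd_subXX => //; [apply: cycintX; apply: cycintD
                              | apply: cycintD; apply: cycintX].
Qed.

(** Powers with exponent [p ^ N] are additive modulo [p], so the congruence spreads from roots of
    unity to their sums; oddness of [p] takes care of signs. *)
Lemma cycint_frobenius n p N d (u : {rmorphism algC -> algC}) x :
    prime p -> odd p -> cycdvd n d p%:R ->
    (forall z, z ^+ n = 1 -> cycdvd n d (u z - z ^+ (p ^ N))) ->
  cycint n x -> cycdvd n d (u x - x ^+ (p ^ N)).
Proof.
move=> pp po dp Hu.
have frobD a b : cycint n a -> cycint n b ->
    cycdvd n d (a ^+ (p ^ N) + b ^+ (p ^ N) - (a + b) ^+ (p ^ N)).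
  move=> Ha Hb; rewrite -opprB; apply: cycdvdN.
  have [y Hy ->] := cycint_frobD_iter N pp Ha Hb.
  exact: cycdvdMr.
have step a b : cycint n a -> cycint n b -> cycdvd n d (u a - a ^+ (p ^ N)) ->
    cycdvd n d (u b - b ^+ (p ^ N)) -> cycdvd n d (u (a + b) - (a + b) ^+ (p ^ N)).
  move=> Ha Hb Ea Eb; rewrite rmorphD /=.
  have -> : u a + u b - (a + b) ^+ (p ^ N) = (u a - a ^+ (p ^ N)) +
     (u b - b ^+ (p ^ N)) + (a ^+ (p ^ N) + b ^+ (p ^ N) - (a + b) ^+ (p ^ N)) by ring.
  by apply: cycdvdD; [apply: cycdvdD | apply: frobD].
elim=> [|y z Hy IH zn|y z Hy IH zn].
- by rewrite rmorph0 expr0n expn_eq0 -leqn0 leqNgt prime_gt0 //= subrr; apply: cycdvd0.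
- by apply: step => //; [apply: cycint_root | apply: Hu].
- apply: step => //; first exact/cycintN/cycint_root.
  rewrite rmorphN exprNn -signr_odd oddX po orbT expr1 mulN1r -opprD.
  exact/cycdvdN/Hu.
Qed.

(* An automorphism that induces a Frobenius map modulo [lam] preserves the
   valuations at all primes above [lam].  In the induction step the quotient [d]
   of [u a * b] by [lam ^+ k.+1] kills [a] and [b] modulo [lam], so the
   hypothesis for [k] applies to [d * a / lam] and [d * b / lam]. *)
Lemma frobenius_valuation n lam q (u : {rmorphism algC -> algC}) :
    lam != 0 -> u lam = lam -> (0 < q)%N -> cycint n lam ->
    (forall x, cycint n x -> cycdvd n lam (u x - x ^+ q)) ->
    (forall x, cycint n x -> cycdvd n lam (x ^+ q.+2) -> cycdvd n lam x) ->
  forall k a b, cycint n a -> cycint n b ->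
    cycdvd n (lam ^+ k) (a * b) -> cycdvd n (lam ^+ k) (u a * b).
Proof.
move=> lam0 ulam q0 Hlam frob red.
have redM d e : cycint n d -> cycint n e -> cycdvd n lam (d * e ^+ q) -> cycdvd n lam (d * e).
  move=> Hd He Hde; apply: red; first exact: cycintM.
  have -> : (d * e) ^+ q.+2 = d * e ^+ q * (d ^+ q.+1 * e ^+ 2).
    by rewrite exprMn exprS -addn2 exprD; ring.
  by apply: cycdvdMr => //; apply: cycintM; apply: cycintX.
elim/ltn_ind=> [[|[|k]]] IH a b Ha Hb Hab.
- by exists (u a * b); rewrite ?expr0 ?mul1r //; apply: cycintM => //; apply: cycint_rmorph.
- rewrite expr1 in Hab *.
  have -> : u a * b = (u a - a ^+ q) * b + a * b * a ^+ q.-1.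
    by rewrite -[in a ^+ q](prednK q0) exprS; ring.
  apply: cycdvdD; last by apply: cycdvdMr => //; apply: cycintX.
  by apply: cycdvdMr => //; apply: frob.
case: (Hab) => c Hc Ec.
have [|d Hd Ed] := IH k.+1 (ltnSn _) a b Ha Hb.
  by exists (lam * c); [apply: cycintM | rewrite Ec exprSr mulrA].
have lamX j : lam ^+ j != 0 by rewrite expf_neq0.
have [b' Hb' Eb'] : cycdvd n lam (d * b).
  apply: redM => //.
  have -> : d * b ^+ q = d * u b - d * (u b - b ^+ q) by ring.
  apply: cycdvdB; last by apply: cycdvdMl => //; apply: frob.
  exists (u c * b); first by apply: cycintM => //; apply: cycint_rmorph.
  apply: (mulfI (lamX k.+1)); rewrite mulrA -Ed mulrAC -rmorphM Ec rmorphM rmorphXn /= ulam.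
  by rewrite exprSr; ring.
have [a' Ha' Ea'] : cycdvd n lam (d * a).
  exists (u a * c); first by apply: cycintM => //; apply: cycint_rmorph.
  apply: (mulfI (lamX k.+1)); rewrite mulrA -Ed.
  have -> : u a * b * a = u a * (a * b) by ring.
  by rewrite Ec exprSr; ring.
have [|e He Ee] := IH k (ltnW (ltnSn _)) a' b' Ha' Hb'.
  exists (d ^+ 2 * c); first by apply: cycintM => //; apply: cycintX.
  apply: (mulfI (lamX 2)).
  have -> : lam ^+ 2 * (a' * b') = (lam * a') * (lam * b') by ring.
  rewrite -Ea' -Eb'.
  have -> : d * a * (d * b) = d ^+ 2 * (a * b) by ring.
  by rewrite Ec !exprSr; ring.
(* It remains to kill [d] itself: [u d * d ^+ 2 = lam * e], and [u d] is congruent to [d ^+ q], so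
   [lam] divides [d ^+ q.+2] and [red] applies. *)
suff [d' Hd' Ed'] : cycdvd n lam d.
  by exists d' => //; rewrite Ed Ed' mulrA -exprSr.
apply: red => //.
have -> : d ^+ q.+2 = u d * d ^+ 2 - (u d - d ^+ q) * d ^+ 2.
  by rewrite -addn2 exprD; ring.
apply: cycdvdB; last by apply: cycdvdMr; [apply: cycintX | apply: frob].
exists e => //; apply: (mulfI (lamX k.+1)).
have -> : lam ^+ k.+1 * (u d * d ^+ 2) = u d * d * (lam ^+ k.+1 * d) by ring.
rewrite -Ed; have -> : u d * d * (u a * b) = u (d * a) * (d * b) by rewrite rmorphM; ring.
rewrite Ea' Eb' rmorphM /= ulam.
have -> : lam * u a' * (lam * b') = lam ^+ 2 * (u a' * b') by ring.
by rewrite Ee [lam ^+ k.+1]exprS; ring.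
Qed.

(** Parseval without the zero frequency. The left side ignores a constant added to [h], and
    therefore becomes a sum over differences. *)
Lemma parseval_offdiag n z (h : 'I_n -> algC) : n.-primitive_root z ->
  2 * \sum_(t < n | val t != 0) `|\sum_(i < n) z ^+ (t * i) * h i| ^+ 2 =
  \sum_(i < n) \sum_(j < n) `|h i - h j| ^+ 2.
Proof.
move=> zp; have n0 := prim_order_gt0 zp.
have := parseval h zp.
rewrite (bigD1 (Ordinal n0)) //= => E.
have -> : \sum_(t < n | val t != 0) `|\sum_(i < n) z ^+ (t * i) * h i| ^+ 2 =
   n%:R * (\sum_(j < n) `|h j| ^+ 2) - `|\sum_(j < n) h j| ^+ 2.
  rewrite -E addrC; under [X in `|X|]eq_bigr do rewrite mul0n expr0 mul1r.
  by rewrite addrK.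
under [RHS]eq_bigr => i _.
  under eq_bigr => j _.
    have -> : `|h i - h j| ^+ 2 = `|h i| ^+ 2 + (- (h i * (h j)^*)) +
       (- ((h i)^* * h j)) + `|h j| ^+ 2.
      by rewrite !normCK rmorphB /=; ring.
    over.
  rewrite !big_split /= sumr_const card_ord !sumrN -!mulr_sumr -rmorph_sum.
  over.
rewrite !big_split /= sumr_const card_ord sumrMnl !sumrN -!mulr_suml -rmorph_sum.
rewrite normCK -[(\sum_(i < n) _) *+ n]mulr_natl /=; ring.
Qed.

(** The two factors are powers of [z] whose exponents are the idempotents of the Chinese remainder
    theorem. *)
Lemma unity_root_split m n (z : algC) : coprime m n -> (0 < m)%N -> (0 < n)%N ->
  z ^+ (m * n) = 1 -> exists a b, [/\ a ^+ m = 1, b ^+ n = 1 & z = a * b].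
Proof.
move=> co m0 n0 zmn.
exists (z ^+ chinese m n 1 0), (z ^+ chinese m n 0 1).
have dn : (n %| chinese m n 1 0)%N.
  by have := chinese_modr co 1 0; rewrite mod0n => /eqP.
have dm : (m %| chinese m n 0 1)%N.
  by have := chinese_modl co 0 1; rewrite mod0n => /eqP.
split.
- by case/dvdnP: dn => c ->; rewrite -exprM -mulnA [(n * m)%N]mulnC mulnC exprM zmn expr1n.
- by case/dvdnP: dm => c ->; rewrite -exprM -mulnA mulnC exprM zmn expr1n.
- rewrite -exprD -(expr_mod _ zmn).
  have /eqP -> : chinese m n 1 0 + chinese m n 0 1 == 1 %[mod m * n].
    rewrite chinese_remainder // -modnDml -[X in _ && X]/(_ == _ %[mod n]).
    rewrite (chinese_modl co) modnDml -modnDmr (eqP dm) addn0 eqxx /=.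
    by rewrite -modnDml (eqP dn) add0n (chinese_modr co).
  by rewrite expr_mod // expr1.
Qed.

(** * Cyclotomic integers of modulus squared 27 *)

Lemma exp_eq_mod n (z : algC) a b : z ^+ n = 1 -> a = b %[mod n] -> z ^+ a = z ^+ b.
Proof. by move=> zn ab; rewrite -(expr_mod a zn) ab expr_mod. Qed.

Section FifteenP.

Variables (P N : nat) (w xi : algC).
Hypotheses (P_gt0 : (0 < P)%N) (co15P : coprime 15 P).
Hypotheses (QP : (3 ^ N = 1 %[mod P])%N) (Q5 : (3 ^ N = 3 %[mod 5])%N).
Hypotheses (wp : 3.-primitive_root w) (xip : 5.-primitive_root xi).

Local Notation E := (cycint (3 * P)).
Local Notation S := (cycint (15 * P)).

Let n_gt0 : (0 < 15 * P)%N. Proof. by rewrite muln_gt0. Qed.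
Let w3 : w ^+ 3 = 1 := prim_expr_order wp.
Let xi5 : xi ^+ 5 = 1 := prim_expr_order xip.
Let co5P : coprime 5 P. Proof. by move: co15P; rewrite (@coprimeMl P 3 5) => /andP[]. Qed.

Lemma E_sub_S x : E x -> S x.
Proof. by apply: cycint_dvd; rewrite dvdn_pmul2r. Qed.

Lemma S_w : S w.
Proof. by apply: cycint_root; rewrite -[15%N]/(3 * 5)%N -mulnA exprM w3 expr1n. Qed.

Lemma root15P_split (z : algC) : z ^+ (15 * P) = 1 ->
  exists a c d, [/\ a ^+ 3 = 1, c ^+ 5 = 1, d ^+ P = 1 & z = a * c * d].
Proof.
move=> /(unity_root_split co15P)[]// y [d [y15 dP ->]].
have [//|//|//|//|a [c [a3 c5 ->]]] := @unity_root_split 3 5 y.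
by exists a, c, d.
Qed.

(** For [t] prime to 5 this fixes the 3P-th roots of unity and raises the fifth roots to the power
    [t]. *)
Definition aut5 t := galois_aut (15 * P) (chinese (3 * P) 5 1 t).

Lemma aut5_key t : coprime t 5 -> coprime (chinese (3 * P) 5 1 t) (15 * P).
Proof.
move=> ct; have co : coprime (3 * P) 5 by rewrite coprimeMl /= coprime_sym.
rewrite -[15%N]/(5 * 3)%N -mulnA coprimeMr -coprime_modl (chinese_modr co) coprime_modl ct /=.
by rewrite -coprime_modl (chinese_modl co) coprime_modl coprime1n.
Qed.

Lemma aut5_fix_root t (z : algC) : coprime t 5 -> z ^+ (3 * P) = 1 -> aut5 t z = z.
Proof.
move=> ct zn; have co : coprime (3 * P) 5 by rewrite coprimeMl /= coprime_sym.
rewrite galois_autE ?aut5_key //; last first.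
  by rewrite -[15%N]/(3 * 5)%N mulnAC exprM zn expr1n.
by rewrite (exp_eq_mod zn (chinese_modl co 1 t)) expr1.
Qed.

Lemma aut5_fix t x : coprime t 5 -> E x -> aut5 t x = x.
Proof. by move=> ct; apply: cycint_rmorph_fix => z; apply: aut5_fix_root. Qed.

Lemma aut5_root5 t (z : algC) : coprime t 5 -> z ^+ 5 = 1 -> aut5 t z = z ^+ t.
Proof.
move=> ct z5; have co : coprime (3 * P) 5 by rewrite coprimeMl /= coprime_sym.
rewrite galois_autE ?aut5_key //; last first.
  by rewrite -[15%N]/(5 * 3)%N -mulnA exprM z5 expr1n.
by rewrite (exp_eq_mod z5 (chinese_modr co 1 t)).
Qed.

(** * Coordinates along the powers of [xi] *)

Local Notation rho := (aut5 3).

Lemma S_decomp x : S x ->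
  exists2 h : 'I_5 -> algC, forall i, E (h i) & x = \sum_(i < 5) xi ^+ i * h i.
Proof.
have rootE (z : algC) : z ^+ (15 * P) = 1 ->
    exists i : 'I_5, exists2 e : algC, e ^+ (3 * P) = 1 & z = xi ^+ i * e.
  move=> /root15P_split[a [c [d [a3 c5 dP ->]]]].
  have [i ->] := prim_rootP xip c5; exists i, (a * d); last by ring.
  by rewrite exprMn exprM a3 expr1n mul1r mulnC exprM dP expr1n.
elim=> [|y z _ [h Hh ->] /rootE[i [e en ->]]|y z _ [h Hh ->] /rootE[i [e en ->]]].
- by exists (fun=> 0) => [i|]; [apply: cycint0 | rewrite big1 // => i _; rewrite mulr0].
- exists (fun j => h j + (if j == i then e else 0)) => [j|].
    by apply: cycintD => //; case: eqP => _; [apply: cycint_root | apply: cycint0].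
  under [RHS]eq_bigr do rewrite mulrDr.
  rewrite big_split /= [X in _ = _ + X](bigD1 i) //= eqxx [X in _ = _ + (_ + X)]big1 ?addr0 //.
  by move=> j /negPf->; rewrite mulr0.
- exists (fun j => h j - (if j == i then e else 0)) => [j|].
    by apply: cycintB => //; case: eqP => _; [apply: cycint_root | apply: cycint0].
  under [RHS]eq_bigr do rewrite mulrBr.
  rewrite sumrB /= [X in _ = _ - X](bigD1 i) //= eqxx [X in _ = _ - (_ + X)]big1 ?addr0 //.
  by move=> j /negPf->; rewrite mulr0.
Qed.

Lemma coprime5 (t : 'I_5) : val t != 0%N -> coprime t 5.
Proof. by case: t => [[|[|[|[|[|]]]]]]. Qed.

Lemma aut5_sum (t : 'I_5) h : val t != 0%N -> (forall i, E (h i)) ->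
  aut5 t (\sum_(i < 5) xi ^+ i * h i) = \sum_(i < 5) xi ^+ (t * i) * h i.
Proof.
move=> /coprime5 ct Hh; rewrite rmorph_sum; apply: eq_bigr => i _.
by rewrite rmorphM rmorphXn /= aut5_root5 // aut5_fix // -exprM.
Qed.

(** All conjugates of the sum under [aut5] vanish, so the sum of the squared differences is 0.
    Coordinates are thus unique up to a common constant. *)
Lemma xi_indep (h : 'I_5 -> algC) : (forall i, E (h i)) ->
  \sum_(i < 5) xi ^+ i * h i = 0 -> forall i j, h i = h j.
Proof.
move=> Hh h0 i j.
have := parseval_offdiag h xip; rewrite big1 ?mulr0 => [/esym|t t0]; last first.
  by rewrite -aut5_sum // h0 rmorph0 normr0 expr0n.
move/psumr_eq0P => /(_ (fun k _ => sumr_ge0 _ (fun l _ => exprn_ge0 2 (normr_ge0 (h k - h l))))).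
move=> /(_ i isT)/psumr_eq0P => /(_ (fun l _ => exprn_ge0 2 (normr_ge0 (h i - h l)))) /(_ j isT).
by move/eqP; rewrite expf_eq0 /= normr_eq0 subr_eq0 => /eqP.
Qed.

(** If every index differed from at least two others, there would be at least 10 ordered pairs of
    distinct values. *)
Lemma five_almost_constant (T : eqType) (h : 'I_5 -> T) :
  (\sum_(i < 5) \sum_(j < 5) (h i != h j) <= 8)%N ->
  exists c, forall i j, i != c -> j != c -> h i = h j.
Proof.
move=> H; have [i Hi] : exists i, (\sum_(j < 5) (h i != h j) <= 1)%N.
  apply/existsP; apply/contraT; rewrite negb_exists => /forallP K.
  suff : (10 <= 8)%N by [].
  apply: leq_trans H.
  have -> : (10 = \sum_(i < 5) 2)%N by rewrite sum_nat_const card_ord.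
  by apply: leq_sum => i _; rewrite ltnNge.
case: (pickP (fun c => h i != h c)) => [c hc|all_eq].
  exists c => k l kc lc.
  have Hk m : m != c -> h i = h m.
    move=> mc; apply/eqP/contraT => him; move: Hi.
    by rewrite (bigD1 c) //= hc (bigD1 m) //= him.
  by rewrite -(Hk k) // (Hk l).
exists i => k l _ _.
by have /negbFE/eqP <- := all_eq k; have /negbFE/eqP <- := all_eq l.
Qed.

Lemma xi_neq1 : xi != 1.
Proof. by rewrite -[xi]expr1 -(prim_order_dvd xip). Qed.

(** The five powers of [xi] sum to 0, so [t] may be subtracted from every coordinate. *)
Lemma xi_sum_almost_constant (h : 'I_5 -> algC) c t : (forall i, i != c -> h i = t) ->
  \sum_(i < 5) xi ^+ i * h i = xi ^+ c * (h c - t).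
Proof.
move=> Hc; have sum0 : \sum_(i < 5) xi ^+ i * t = 0.
  by rewrite -mulr_suml sum_unity_root // (negPf xi_neq1) mulr0n mul0r.
transitivity (\sum_(i < 5) (xi ^+ i * h i - xi ^+ i * t)).
  by rewrite sumrB sum0 subr0.
rewrite (bigD1 c) //= [X in _ + X]big1 ?addr0 ?mulrBr //.
by move=> i ic; rewrite Hc // subrr.
Qed.

(* Averaging over the Galois group, at most four pairs of coordinates of [eta]
   can differ. *)
Lemma S_unit_modulus eta : S eta ->
    (forall u : {rmorphism algC -> algC}, `|u eta| ^+ 2 = 1) ->
  exists (c : 'I_5) h, E h /\ eta = xi ^+ c * h.
Proof.
move=> Seta eta1; have [h Hh Eeta] := S_decomp Seta.
have n0 := n_gt0; set n := (15 * P)%N in n0 *.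
(* Each of the four nonzero frequencies contributes 1, as it is a conjugate of [eta]; the factor 2
   makes 8. *)
have Hk k : coprime k n ->
    \sum_(i < 5) \sum_(j < 5) `|galois_aut n k (h i - h j)| ^+ 2 = 8.
  move=> ck; set u := galois_aut n k.
  have uxip : 5.-primitive_root (u xi) by rewrite fmorph_primitive_root.
  have := parseval_offdiag (fun i => u (h i)) uxip.
  under [X in _ * X]eq_bigr => t t0.
    have -> : \sum_(i < 5) u xi ^+ (t * i) * u (h i) = (u \o aut5 t) eta.
      rewrite /= Eeta aut5_sum // rmorph_sum; apply: eq_bigr => i _.
      by rewrite rmorphM rmorphXn.
    rewrite eta1; over.
  rewrite sumr_const.
  have -> : #|[pred t : 'I_5 | val t != 0%N]| = 4%N.
    by rewrite -sum1_card big_mkcond /= !big_ord_recl big_ord0.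
  move=> EE; rewrite -[8]/((2 * 4)%:R) natrM EE.
  by apply: eq_bigr => i _; apply: eq_bigr => j _; rewrite rmorphB.
have tot0 : (0 < totient n)%N by rewrite totient_gt0.
(* Every nonzero difference has trace at least [totient n], so at most 8 ordered pairs differ. *)
have : (totient n)%:R * (\sum_(i < 5) \sum_(j < 5) (h i != h j))%:R <=
       (totient n)%:R * 8%:R :> algC.
  have -> : (totient n)%:R * 8%:R = \sum_(i < 5) \sum_(j < 5)
      \sum_(k < n | coprime k n) `|galois_aut n k (h i - h j)| ^+ 2 :> algC.
    transitivity (\sum_(k < n | coprime k n) 8%:R : algC).
      by rewrite sumr_const card_coprime // mulr_natl.
    under [RHS]eq_bigr do rewrite exchange_big /=.
    by rewrite [RHS]exchange_big /=; apply: eq_bigr => k ck; rewrite Hk.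
  rewrite natr_sum mulr_sumr; apply: ler_sum => i _.
  rewrite natr_sum mulr_sumr; apply: ler_sum => j _.
  have [->|hij] := eqVneq (h i) (h j).
    by rewrite mulr0 sumr_ge0 // => k _; rewrite exprn_ge0.
  rewrite mulr1; apply: cycint_trace_ge => //; last by rewrite subr_eq0.
  by apply: E_sub_S; apply: cycintB.
rewrite ler_pM2l ?ltr0n // ler_nat => /five_almost_constant[c Hc].
pose c' : 'I_5 := if c == ord0 then ord_max else ord0.
have c'c : c' != c by rewrite /c'; have [->|] := eqVneq c ord0; rewrite // eq_sym.
exists c, (h c - h c'); split; first exact: cycintB.
by rewrite Eeta; apply: xi_sum_almost_constant => i ic; apply: Hc.
Qed.


(** * The element [lam] above 3 and the automorphism [rho] *)

Local Notation lam := (1 - w).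

Lemma w_quad : w ^+ 2 = - 1 - w.
Proof.
have w1 : w - 1 != 0.
  have : w ^+ 1 != w ^+ 0 by rewrite (eq_prim_root_expr wp).
  by rewrite expr1 expr0 subr_eq0.
have : (w - 1) * (w ^+ 2 + w + 1) = 0.
  by transitivity (w ^+ 3 - 1); [ring | rewrite w3 subrr].
by move/eqP; rewrite mulf_eq0 (negPf w1) /= => /eqP H; rewrite -[LHS]subr0 -H; ring.
Qed.

(** Since [lam ^+ 2 = -3 * w], the number 27 is a power of [lam] up to sign. *)
Lemma lamX6 : lam ^+ 6 = - 27.
Proof.
have -> : lam ^+ 6 = (1 - 2 * w + w ^+ 2) ^+ 3 by ring.
rewrite w_quad; have -> : (1 - 2 * w + (-1 - w)) ^+ 3 = - 27 * w ^+ 3 by ring.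
by rewrite w3 mulr1.
Qed.

Lemma lam_neq0 : lam != 0.
Proof. by apply: contra_eq_neq lamX6 => ->; rewrite expr0n /= eq_sym oppr_eq0 pnatr_eq0. Qed.

Lemma S_lam : S lam.
Proof. by apply: cycintB; [apply: cycint1 | apply: S_w]. Qed.

Lemma lam_dvd_root3 n (a : algC) : (3 %| n)%N -> a ^+ 3 = 1 -> cycdvd n lam (a - 1).
Proof.
case/dvdnP=> m -> /(prim_rootP wp)[i ->].
exists (- \sum_(j < i) w ^+ j); last by rewrite subrX1; ring.
apply/cycintN/cycint_sum => j _; apply: cycint_root.
by rewrite exprAC mulnC exprM w3 !expr1n.
Qed.

(** By the choice of [N], the power [3 ^ N] is the identity on P-th roots of unity and cubing on
    fifth roots, as is [rho]. On cube roots of unity it gives 1, to which they are all congruent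
    modulo [lam]. *)
Lemma rho_frob x : S x -> cycdvd (15 * P) lam (rho x - x ^+ (3 ^ N)).
Proof.
apply: cycint_frobenius => //.
  exists (1 - w ^+ 2).
    by apply: cycintB; [apply: cycint1 | apply/cycintX/S_w].
  by transitivity (1 - w - w ^+ 2 + w ^+ 3); [rewrite w_quad w3; ring | ring].
move=> z /root15P_split[a [c [d [a3 c5 dP ->]]]].
have fix3 : rho a = a by apply: aut5_fix_root => //; rewrite exprM a3 expr1n.
have fixP : rho d = d by apply: aut5_fix_root => //; rewrite mulnC exprM dP expr1n.
rewrite !rmorphM /= fix3 fixP aut5_root5 // !exprMn.
have N0 : (0 < N)%N by case: N Q5.
rewrite (exp_eq_mod c5 Q5) (exp_eq_mod dP QP) expr1.
rewrite -[N in a ^+ (3 ^ N)](prednK N0) expnS exprM a3 expr1n mul1r.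
have -> : a * c ^+ 3 * d - c ^+ 3 * d = (a - 1) * (c ^+ 3 * d) by ring.
apply: cycdvdMr; last by apply: lam_dvd_root3 => //; rewrite (@dvdn_mulr _ 15).
apply: cycint_root; rewrite exprMn.
have -> : d ^+ (15 * P) = 1 by rewrite mulnC exprM dP expr1n.
rewrite mulr1.
by rewrite exprAC -[15%N]/(5 * 3)%N -mulnA exprM c5 !expr1n.
Qed.

Lemma rho4 x : S x -> rho (rho (rho (rho x))) = x.
Proof.
apply: (cycint_rmorph_fix (u := (rho \o rho) \o (rho \o rho))).
move=> z /root15P_split[a [c [d [a3 c5 dP ->]]]] /=.
have fix3 : rho a = a by apply: aut5_fix_root => //; rewrite exprM a3 expr1n.
have fixP : rho d = d by apply: aut5_fix_root => //; rewrite mulnC exprM dP expr1n.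
have rho_c : rho c = c ^+ 3 by apply: aut5_root5.
rewrite !rmorphM /= !fix3 !fixP rho_c.
do 3!rewrite !rmorphXn /= rho_c.
by rewrite -!exprM (@exp_eq_mod 5 _ _ 1) // expr1.
Qed.

(** The quotient by [lam] is reduced: with [Q = 3 ^ N], four applications of [rho] give the
    congruence of [x] with [x ^+ K], where [K] is the fourth power of [Q] and is at least [Q.+2]. *)
Lemma lam_reduced x : S x -> cycdvd (15 * P) lam (x ^+ (3 ^ N).+2) ->
  cycdvd (15 * P) lam x.
Proof.
move=> Sx Hx; set Q := (3 ^ N)%N in Hx *.
have Srho y : S y -> S (rho y) by apply: cycint_rmorph.
have Q3 : (3 <= Q)%N.
  have : (Q %% 5 = 3)%N by rewrite Q5.
  by move=> E5; rewrite -E5 leq_mod.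
have step y k : S y -> cycdvd (15 * P) lam (y - x ^+ k) ->
    cycdvd (15 * P) lam (rho y - x ^+ (k * Q)).
  move=> Sy Hy.
  have -> : rho y - x ^+ (k * Q) = (rho y - y ^+ Q) + (y ^+ Q - (x ^+ k) ^+ Q).
    by rewrite exprM; ring.
  apply: cycdvdD; first exact: rho_frob.
  by apply: cycdvd_subXX => //; apply: cycintX.
have H0 : cycdvd (15 * P) lam (x - x ^+ 1) by rewrite expr1 subrr; apply: cycdvd0.
have {}H0 := step _ _ Sx H0.
have {}H0 := step _ _ (Srho _ Sx) H0.
have {}H0 := step _ _ (Srho _ (Srho _ Sx)) H0.
have {}H0 := step _ _ (Srho _ (Srho _ (Srho _ Sx))) H0.
rewrite rho4 // in H0; set K := (_ * Q)%N in H0.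
have KQ : (Q.+2 <= K)%N.
  have Q0 : (0 < Q)%N by apply: leq_trans Q3.
  apply: (@leq_trans (3 * Q)); first by move: Q3; clear; lia.
  rewrite /K mul1n leq_mul2r; apply/orP; right; apply: (leq_trans Q3).
  by rewrite -mulnA leq_pmulr // muln_gt0 Q0.
have -> : x = (x - x ^+ K) + x ^+ Q.+2 * x ^+ (K - Q.+2).
  by rewrite -exprD subnKC //; ring.
by apply: cycdvdD => //; apply: cycdvdMr => //; apply: cycintX.
Qed.

Lemma normC27_neq0 (a : algC) : `|a| ^+ 2 = 27 -> a != 0.
Proof.
by move=> a27; apply: contra_eq_neq a27 => ->; rewrite normr0 expr0n eq_sym pnatr_eq0.
Qed.

(** As [lam ^+ 6] divides the product of [a] and its conjugate, it divides the product with [rho a]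
    in place of [a]. The quotient is, up to sign, [rho a] over [a], and all its conjugates have
    modulus 1. *)
Lemma rho_multiplier a : S a -> `|a| ^+ 2 = 27 ->
  exists (c : 'I_5) h, E h /\ rho a = xi ^+ c * h * a.
Proof.
move=> Sa a27; have Sac := cycint_conj n_gt0 Sa.
have a0 := normC27_neq0 a27.
have [eta' Heta' Eeta'] : cycdvd (15 * P) (lam ^+ 6) (rho a * a^*).
  apply: (@frobenius_valuation _ _ (3 ^ N)) => //.
  - exact: lam_neq0.
  - rewrite rmorphB rmorph1; congr (_ - _).
    by apply: aut5_fix_root => //; rewrite exprM w3 expr1n.
  - by rewrite expn_gt0.
  - exact: S_lam.
  - exact: rho_frob.
  - exact: lam_reduced.
  - by exists (- 1); [apply/cycintN/cycint1 | rewrite -normCK a27 lamX6; ring].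
pose eta := - eta'; have Seta : S eta by apply: cycintN.
have rho_a : rho a = eta * a.
  apply: (mulIf (x := a^*)); first by rewrite conjC_eq0.
  by rewrite Eeta' lamX6 -mulrA -normCK a27 /eta; ring.
have eta1 (u : {rmorphism algC -> algC}) : `|u eta| ^+ 2 = 1.
  rewrite (cycint_normC_rmorph u n_gt0 Seta).
  suff -> : `|eta| ^+ 2 = 1 by rewrite rmorph1.
  apply: (mulIf (x := 27)); first by rewrite pnatr_eq0.
  rewrite -{1}a27 -exprMn -normrM -rho_a (cycint_normC_rmorph _ n_gt0 Sa) a27.
  by rewrite mul1r rmorph_nat.
have [c [h [Eh Eeta]]] := S_unit_modulus Seta eta1.
by exists c, h; rewrite -Eeta.
Qed.

(** The automorphism [rho] moves only fifth roots of unity, and these are all congruent to 1 modulo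
    [1 - xi]. *)
Lemma rho_sub x : S x -> cycdvd (15 * P) (1 - xi) (rho x - x).
Proof.
have Hroot z : z ^+ (15 * P) = 1 -> cycdvd (15 * P) (1 - xi) (rho z - z).
  move=> /root15P_split[a [c [d [a3 c5 dP ->]]]].
  have fix3 : rho a = a by apply: aut5_fix_root => //; rewrite exprM a3 expr1n.
  have fixP : rho d = d by apply: aut5_fix_root => //; rewrite mulnC exprM dP expr1n.
  rewrite !rmorphM /= fix3 fixP aut5_root5 //.
  have Sroot y k : y ^+ k = 1 -> (k %| 15 * P)%N -> S y.
    by move=> yk /dvdnP[m ->]; apply: cycint_root; rewrite mulnC exprM yk expr1n.
  have Sa := Sroot _ _ a3 (dvdn_mulr P (isT : (3 %| 15)%N)).
  have Sc := Sroot _ _ c5 (dvdn_mulr P (isT : (5 %| 15)%N)).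
  have Sd := Sroot _ _ dP (dvdn_mull 15 (dvdnn P)).
  have -> : a * c ^+ 3 * d - a * c * d = (c ^+ 2 - 1) * (a * c * d) by ring.
  apply: cycdvdMr; first by do 2!apply: cycintM => //.
  have [i ->] := prim_rootP xip c5; rewrite -exprM subrX1.
  exists (- \sum_(j < i * 2) xi ^+ j); last by ring.
  apply/cycintN/cycint_sum => j _; apply: cycintX.
  exact: Sroot xi5 (dvdn_mulr P (isT : (5 %| 15)%N)).
elim=> [|y z _ IH zn|y z _ IH zn]; first by rewrite rmorph0 subrr; apply: cycdvd0.
- rewrite rmorphD /=; have -> : rho y + rho z - (y + z) = (rho y - y) + (rho z - z) by ring.
  by apply: cycdvdD => //; apply: Hroot.
- rewrite rmorphB /=; have -> : rho y - rho z - (y - z) = (rho y - y) - (rho z - z) by ring.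
  by apply: cycdvdB => //; apply: Hroot.
Qed.

Lemma xi_sum0 : 1 + xi + xi ^+ 2 + xi ^+ 3 + xi ^+ 4 = 0.
Proof.
have := @sum_unity_root 5 xi isT xi5; rewrite (negPf xi_neq1) mulr0n => <-.
by rewrite !big_ord_recr big_ord0 /= expr0 expr1 add0r.
Qed.

(** A power of [xi] absorbs the one in the multiplier of [rho]. The remaining multiplier [h]
    satisfies [h ^+ 4 = 1], and it is 1 because [rho] acts trivially modulo [1 - xi]. *)
Lemma rho_fixed a : S a -> `|a| ^+ 2 = 27 ->
  exists c : 'I_5, rho (xi ^+ c * a) = xi ^+ c * a.
Proof.
move=> Sa a27; have [c [h [Eh rho_a]]] := rho_multiplier Sa a27.
have xiM k : xi ^+ k = xi ^+ (inZp k : 'I_5) by rewrite /= expr_mod.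
(* The exponent [2c] works because [rho] turns it into [6c], and [6c + c] is [2c] modulo 5. *)
exists (inZp (c * 2)); rewrite -xiM; set b := xi ^+ _ * a.
have S_xi k : S (xi ^+ k).
  by apply/cycintX/cycint_root; rewrite -[15%N]/(5 * 3)%N -mulnA exprM xi5 expr1n.
have Sb : S b by apply: cycintM.
have b27 : `|b| ^+ 2 = 27.
  by rewrite normrM normrX (unity_root_norm _ xi5) // expr1n mul1r.
have b0 := normC27_neq0 b27.
have rho_b : rho b = h * b.
  rewrite rmorphM /= rho_a rmorphXn /= aut5_root5 // -exprM /b.
  rewrite !mulrA -exprD (@exp_eq_mod 5 _ _ (c * 2) xi5); first by ring.
  by rewrite (_ : _ + _ = c * 5 + c * 2)%N ?modnMDl //; lia.
have rho_h : rho h = h by apply: aut5_fix.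
have h4 : h ^+ 4 = 1.
  apply: (mulIf b0); rewrite mul1r -[RHS](rho4 Sb).
  have rho_hX k : rho (h ^+ k * b) = h ^+ k.+1 * b.
    by rewrite rmorphM rmorphXn /= rho_h rho_b exprSr mulrA.
  by rewrite rho_b -{2}[h]expr1 !rho_hX.
suff h_eq1 : h = 1 by rewrite rho_b h_eq1 mul1r.
apply/eqP/contraT => h1.
have [y Sy Ey] : cycdvd (15 * P) (1 - xi) ((h - 1) * 27).
  have -> : (h - 1) * 27 = (rho b - b) * b^*.
    by rewrite rho_b -b27 normCK; ring.
  by apply: cycdvdMr; [apply: cycint_conj | apply: rho_sub].
(* The prime 5 is totally ramified: it divides the fourth power of [1 - xi]. So 5 divides
   [(h - 1) ^+ 4] whenever that is an integer, whereas the candidates -1 and the square roots of -1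
   give 16 and -4. *)
have xi4 : (1 - xi) ^+ 4 = 5 * (- xi + xi ^+ 2 - xi ^+ 3).
  rewrite -[LHS]subr0 -xi_sum0; ring.
have dvd5 (m : int) : (h - 1) ^+ 4 = m%:~R -> (5 %| m)%Z.
  move=> Em; have [t cot Et] : exists2 t : int, coprimez 5 t & t%:~R = 27 ^+ 4 :> algC.
    by exists (27 ^+ 4); [rewrite coprimezXr | rewrite rmorphXn].
  rewrite -(Gauss_dvdzl _ cot).
  apply: (@cycint_dvd_int (15 * P) _ _ ((- xi + xi ^+ 2 - xi ^+ 3) * y ^+ 4)) => //.
    apply: cycintM; last exact: cycintX.
    have := S_xi 1%N; rewrite expr1 => Sx.
    by apply: cycintB => //; apply: cycintD => //; apply: cycintN.
  by rewrite intrM -Em Et -exprMn Ey exprMn xi4 -mulrA.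
have : (h + 1) * (h ^+ 2 + 1) = 0.
  apply: (mulfI (x := h - 1)); first by rewrite subr_eq0.
  by transitivity (h ^+ 4 - 1); [ring | rewrite h4 subrr mulr0].
move/eqP; rewrite mulf_eq0 => /orP[] /eqP H.
  have Eh1 : h = -1 by rewrite -[LHS]subr0 -H; ring.
  by have /dvd5 : (h - 1) ^+ 4 = 16%:~R by rewrite Eh1; ring.
have h2 : h ^+ 2 = -1 by rewrite -[LHS]subr0 -H; ring.
have /dvd5 // : (h - 1) ^+ 4 = (-4)%:~R.
have -> : (h - 1) ^+ 4 = (h ^+ 2 - 2 * h + 1) ^+ 2 by ring.
rewrite h2; have -> : (-1 - 2 * h + 1) ^+ 2 = 4 * h ^+ 2 by ring.
by rewrite h2; ring.
Qed.

(** After multiplication by a power of [xi] the sum is fixed by [rho], so its coordinates [g] are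
    invariant under doubling the index. As 2 generates the units modulo 5, [g] is constant off 0. *)
Lemma almost_constant (h : 'I_5 -> algC) : (forall i, E (h i)) ->
    `|\sum_(i < 5) xi ^+ i * h i| ^+ 2 = 27 ->
  exists c, forall i j, i != c -> j != c -> h i = h j.
Proof.
move=> Hh a27; set a := \sum_(i < 5) _ in a27.
have Sa : S a.
  apply: cycint_sum => i _; apply: cycintM; last exact: E_sub_S.
  by apply/cycintX/cycint_root; rewrite -[15%N]/(5 * 3)%N -mulnA exprM xi5 expr1n.
have [c Hc] := rho_fixed Sa a27.
have xiM k : xi ^+ k = xi ^+ (inZp k : 'I_5) by rewrite /= expr_mod.
pose g (i : 'I_5) := h (i - c).
have Hg i : E (g i) by apply: Hh.
have Eg : xi ^+ c * a = \sum_(i < 5) xi ^+ i * g i.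
  rewrite mulr_sumr (reindex_inj (addrI (- c))) /=; apply: eq_bigr => i _.
  rewrite /g [i - c]addrC mulrA -exprD xiM; congr (xi ^+ _ * _).
  rewrite [X in nat_of_ord X](_ : _ = c + (- c + i)); first by rewrite addrA subrr add0r.
  exact/val_inj.
(* Since [rho] triples the exponents, the coordinate at [i] is now the old one at [2i], 2 being the
   inverse of 3 modulo 5. *)
have Eg2 : rho (xi ^+ c * a) = \sum_(i < 5) xi ^+ i * g (2 * i).
  have inj2 : injective (fun i : 'I_5 => 2 * i).
    apply: (can_inj (g := fun i : 'I_5 => 3 * i)) => i.
    by rewrite mulrA; apply/val_inj; case: i => [[|[|[|[|[|]]]]]].
  rewrite Eg (@aut5_sum (Ordinal (isT : (3 < 5)%N)) g) //=.
  rewrite (reindex_inj inj2) /=; apply: eq_bigr => i _; congr (_ * _).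
  rewrite xiM; congr (xi ^+ _).
  by case: i => [[|[|[|[|[|]]]]]].
have Hd : forall i j, g (2 * i) - g i = g (2 * j) - g j.
  apply: xi_indep => [i|]; first exact: cycintB.
  under eq_bigr do rewrite mulrBr.
  by rewrite sumrB -Eg2 -Eg Hc subrr.
have g2 i : g (2 * i) = g i.
  by apply/eqP; rewrite -subr_eq0 (Hd i 0) mulr0 subrr.
have gc i : i != 0 -> g i = g 1.
  have E2 : g 2 = g 1 by rewrite -[RHS]g2 mulr1.
  have E4 : g 4 = g 1 by rewrite -E2 -[RHS]g2; congr g; apply/val_inj.
  have E3 : g 3 = g 1 by rewrite -E4 -[RHS]g2; congr g; apply/val_inj.
  case: i => [[|[|[|[|[|]]]]]] // lti _.
  - by congr g; apply/val_inj.
  - by rewrite -E2; congr g; apply/val_inj.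
  - by rewrite -E3; congr g; apply/val_inj.
  - by rewrite -E4; congr g; apply/val_inj.
exists (- c) => i j ic jc.
have hg k : h k = g (k + c) by rewrite /g addrK.
by rewrite !hg !gc // addr_eq0.
Qed.

End FifteenP.

(** * The augmentation modulo p and the trace form of prime power order *)

(** The residue [s] of [x] under the map from Z[mu_(p^m)] to F_p that sends every root of unity to
    1. Raising to the power [p ^ m] realizes this map modulo [p], and [s] matters only modulo
    [p]. *)
Definition augm p m x (s : int) :=
  cycint (p ^ m) x /\ cycdvd (p ^ m) p%:R (x ^+ (p ^ m) - s%:~R).

Lemma augm_root p m z : z ^+ (p ^ m) = 1 -> augm p m z 1.
Proof.
by move=> zn; split; [apply: cycint_root | rewrite zn subrr; apply: cycdvd0].
Qed.

Lemma augm0 p m : prime p -> augm p m 0 0.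
Proof.
move=> pp; split; first exact: cycint0.
by rewrite expr0n expn_eq0 -leqn0 leqNgt prime_gt0 //= subrr; apply: cycdvd0.
Qed.

Lemma augmD p m x y s t : prime p -> augm p m x s -> augm p m y t ->
  augm p m (x + y) (s + t).
Proof.
move=> pp [Hx Es] [Hy Et]; split; first exact: cycintD.
rewrite intrD; set n := (p ^ m)%N in Hx Hy Es Et *.
have -> : (x + y) ^+ n - (s%:~R + t%:~R) = ((x + y) ^+ n - (x ^+ n + y ^+ n)) +
   ((x ^+ n - s%:~R) + (y ^+ n - t%:~R)) by ring.
by apply: cycdvdD; [apply: cycint_frobD_iter | apply: cycdvdD].
Qed.

Lemma augmM p m x y s t : augm p m x s -> augm p m y t -> augm p m (x * y) (s * t).
Proof.
move=> [Hx Es] [Hy Et]; split; first exact: cycintM.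
rewrite intrM exprMn; set n := (p ^ m)%N in Hx Hy Es Et *.
have -> : x ^+ n * y ^+ n - s%:~R * t%:~R = (x ^+ n - s%:~R) * y ^+ n +
   (y ^+ n - t%:~R) * s%:~R by ring.
by apply: cycdvdD; apply: cycdvdMr => //; [apply: cycintX | apply: cycint_int].
Qed.

Lemma augm_int p m (c : int) : prime p -> odd p -> augm p m c%:~R c.
Proof.
move=> pp po; have Hn k : augm p m k%:R k.
  elim: k => [|k IH]; first exact: augm0.
  by rewrite -addn1 natrD PoszD; apply: augmD => //; apply: augm_root; rewrite expr1n.
case: c => k; first exact: Hn.
have -> : Negz k = -1 * k.+1%:Z by rewrite NegzE mulN1r.
rewrite intrM; apply: augmM; last exact: Hn.
split; first exact: (cycint_int _ (-1)).
rewrite -[(-1)%:~R]/(-1 : algC) -signr_odd oddX po orbT expr1 subrr.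
exact: cycdvd0.
Qed.

Lemma augmB p m x y s t : prime p -> odd p -> augm p m x s -> augm p m y t ->
  augm p m (x - y) (s - t).
Proof.
move=> pp po Hx Hy; apply: augmD => //.
by rewrite -mulN1r -[- t]mulN1r; apply: augmM => //; apply: (augm_int _ (-1)).
Qed.

Lemma augm_sum p m (I : Type) (r : seq I) (Q : pred I) (F : I -> algC) (G : I -> int) :
  prime p -> (forall i, Q i -> augm p m (F i) (G i)) ->
  augm p m (\sum_(i <- r | Q i) F i) (\sum_(i <- r | Q i) G i).
Proof.
move=> pp HF; apply: (big_ind2 (augm p m)) => //; first exact: augm0.
by move=> *; apply: augmD.
Qed.

Lemma augm_conj p m x s : prime p -> augm p m x s -> augm p m x^* s.
Proof.
move=> pp [Hx [y Hy Ey]]; have n0 : (0 < p ^ m)%N by rewrite expn_gt0 prime_gt0.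
split; first exact: cycint_conj.
exists (y^*); first exact: cycint_conj.
by rewrite -(rmorph_nat Num.conj p) -rmorphM -Ey rmorphB rmorphXn /= rmorph_int.
Qed.

Lemma augm_inj p m x s t : prime p -> augm p m x s -> augm p m x t -> (p %| s - t)%Z.
Proof.
move=> pp [_ Es] [_ Et]; have n0 : (0 < p ^ m)%N by rewrite expn_gt0 prime_gt0.
have [y Hy Ey] := cycdvdB Et Es.
apply: (cycint_dvd_int n0 _ Hy); first by rewrite -lt0n prime_gt0.
by rewrite intrB -[RHS]Ey; ring.
Qed.

(** With [e = a + w * b] one finds [x = (a + b) + w * (2 * b - a)]. The automorphism that fixes P-th
    roots and squares [w] fixes [x], so [a = 2 * b] and [x = 3 * b]. *)
Lemma dvd3_of_lam P w x e : (0 < P)%N -> coprime P 3 -> 3.-primitive_root w ->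
  cycint P x -> cycint (3 * P) e -> x = (1 - w) * e ->
  exists2 b, cycint P b & x = 3 * b.
Proof.
move=> P0 co wp Hx He Ex; have w3 := prim_expr_order wp.
have w2 := w_quad wp.
have [a [b [Ha Hb Ee]]] : exists a b, [/\ cycint P a, cycint P b & e = a + w * b].
  have Hr z : z ^+ (3 * P) = 1 -> exists a b, [/\ cycint P a, cycint P b & z = a + w * b].
    rewrite mulnC => /(unity_root_split co)[] // d [y [dP y3 ->]].
    have Hd := cycint_root dP; have [[[|[|[|i]]] //= lti ->]] := prim_rootP wp y3.
    - by exists d, 0; split=> //; [apply: cycint0 | rewrite expr0; ring].
    - by exists 0, d; split=> //; [apply: cycint0 | rewrite expr1; ring].
    - by exists (- d), (- d); rewrite w2; split; [apply: cycintN | apply: cycintN | ring].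
  elim: He => [|y z _ [a [b [Ha Hb ->]]] /Hr[a' [b' [Ha' Hb' ->]]]
                |y z _ [a [b [Ha Hb ->]]] /Hr[a' [b' [Ha' Hb' ->]]]].
  - by exists 0, 0; split; [apply: cycint0 | apply: cycint0 | ring].
  - by exists (a + a'), (b + b'); split; [apply: cycintD | apply: cycintD | ring].
  - by exists (a - a'), (b - b'); split; [apply: cycintB | apply: cycintB | ring].
pose u := galois_aut (P * 3) (chinese P 3 1 2).
have ck : coprime (chinese P 3 1 2) (P * 3).
  rewrite coprimeMr -coprime_modl (chinese_modl co) coprime_modl coprime1n /=.
  by rewrite -coprime_modl (chinese_modr co) coprime_modl.
have u_fix y : cycint P y -> u y = y.
  apply: cycint_rmorph_fix => z zP; rewrite galois_autE // ?exprM ?zP ?expr1n //.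
  by rewrite (exp_eq_mod zP (chinese_modl co 1 2)) expr1.
have uw : u w = w ^+ 2.
  rewrite galois_autE // ?[(P * 3)%N]mulnC ?exprM ?w3 ?expr1n //.
  by rewrite (exp_eq_mod w3 (chinese_modr co 1 2)).
have Ex1 : x = (a + b) + w * (2 * b - a).
  by rewrite Ex Ee; transitivity (a + w * b - w * a - w ^+ 2 * b); [ring | rewrite w2; ring].
have Ex2 : x = (a + b) + w ^+ 2 * (2 * b - a).
  have Hba : cycint P (2 * b - a).
    by apply: cycintB => //; apply: cycintM => //; apply: (cycint_int _ 2).
  by rewrite -[LHS]u_fix // Ex1 rmorphD rmorphM /= uw !u_fix //; apply: cycintD.
exists b => //.
suff E0 : 2 * b - a = 0 by rewrite Ex1 E0 mulr0 addr0 -[a]addr0 -E0; ring.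
have : (w - w ^+ 2) * (2 * b - a) = 0.
  by transitivity (x - x); [rewrite {1}Ex1 Ex2; ring | rewrite subrr].
move/eqP; rewrite mulf_eq0 => /orP[|/eqP //].
by rewrite subr_eq0 -{1}[w]expr1 (eq_prim_root_expr wp).
Qed.

Section PrimePower.

Variables (p m : nat) (th : algC).
Hypotheses (pp : prime p) (thp : (p ^ m.+1)%N.-primitive_root th).

Local Notation P' := (p ^ m)%N.
Local Notation kap := (th ^+ (p ^ m)).

Let P'_gt0 : (0 < P')%N. Proof. by rewrite expn_gt0 prime_gt0. Qed.
Let thP : th ^+ (p ^ m.+1) = 1 := prim_expr_order thp.

(** Integer combination of all roots of unity of order dividing [p ^ m.+1], arranged by cosets of
    mu_p: [k] names the coset and [a] the position in it. The coefficients are not unique. *)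
Definition pcomb (c : 'I_P' -> 'I_p -> int) : algC :=
  \sum_(k < P') \sum_(a < p) (th ^+ k * kap ^+ a) * (c k a)%:~R.

Lemma root_kap (z : algC) : z ^+ (p ^ m.+1) = 1 ->
  exists (k : 'I_P') (a : 'I_p), z = th ^+ k * kap ^+ a.
Proof.
move=> /(prim_rootP thp)[i ->].
have ltk : (i %% P' < P')%N by rewrite ltn_mod.
have lta : (i %/ P' < p)%N by rewrite ltn_divLR // -expnS.
exists (Ordinal ltk), (Ordinal lta) => /=.
by rewrite -exprM -exprD addnC [(P' * _)%N]mulnC -divn_eq.
Qed.

Lemma pcombD c d : pcomb (fun k a => c k a + d k a) = pcomb c + pcomb d.
Proof.
rewrite -big_split; apply: eq_bigr => k _; rewrite -big_split; apply: eq_bigr => a _.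
by rewrite intrD mulrDr.
Qed.

Lemma pcomb_sum (I : Type) (s : seq I) (Q : pred I) (F : I -> 'I_P' -> 'I_p -> int) :
  pcomb (fun k a => \sum_(i <- s | Q i) F i k a) = \sum_(i <- s | Q i) pcomb (F i).
Proof.
rewrite exchange_big /=; apply: eq_bigr => k _.
rewrite exchange_big /=; apply: eq_bigr => a _.
by rewrite rmorph_sum mulr_sumr.
Qed.

Lemma pcombM (e : int) c : pcomb (fun k a => e * c k a) = e%:~R * pcomb c.
Proof.
rewrite mulr_sumr; apply: eq_bigr => k _; rewrite mulr_sumr; apply: eq_bigr => a _.
by rewrite intrM mulrCA.
Qed.

Lemma pcomb_delta k0 a0 :
  pcomb (fun k a => ((k == k0) && (a == a0))%:Z) = th ^+ k0 * kap ^+ a0.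
Proof.
rewrite /pcomb (bigD1 k0) //= [X in _ + X]big1 ?addr0 => [|k /negPf->]; last first.
  by rewrite big1 // => a _; rewrite mulr0.
rewrite (bigD1 a0) //= [X in _ + X]big1 ?addr0 => [|a /negPf->]; last by rewrite andbF mulr0.
by rewrite !eqxx mulr1.
Qed.

Lemma cycint_pcomb x : cycint (p ^ m.+1) x -> exists c, x = pcomb c.
Proof.
elim=> [|y z _ [c ->] /root_kap[k [a ->]]|y z _ [c ->] /root_kap[k [a ->]]].
- by exists (fun _ _ => 0); rewrite /pcomb big1 // => k _; rewrite big1 // => a _; rewrite mulr0.
- by eexists; rewrite -pcomb_delta -pcombD.
- by eexists; rewrite -pcomb_delta -mulN1r -[-1]/((-1)%:~R) -pcombM -pcombD.
Qed.

Lemma pcomb_augm c : odd p -> augm p m.+1 (pcomb c) (\sum_(k < P') \sum_(a < p) c k a).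
Proof.
move=> po; apply: augm_sum => // k _; apply: augm_sum => // a _.
rewrite -[c k a in X in augm _ _ _ X]mul1r; apply: augmM; last exact: augm_int.
by apply: augm_root; rewrite exprMn -!exprM ![(_ * p ^ m.+1)%N]mulnC !exprM thP !expr1n mulr1.
Qed.

(** Parseval over [t2] separates the cosets, and [parseval_offdiag] over [t1] leaves the differences
    within each coset. *)
Lemma pcomb_trace c (v : algC) :
    (forall u : {rmorphism algC -> algC}, `|u (pcomb c)| ^+ 2 = v) ->
  (\sum_(k < P') \sum_(a < p) \sum_(b < p) (c k a - c k b) ^+ 2)%:~R = 2 * (p.-1)%:R * v.
Proof.
move=> Hv; have p0 := prime_gt0 pp.
have thpp : P'.-primitive_root (th ^+ p).
  have := dvdn_prim_root thp (dvdn_exp2l p (leqnSn m)).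
  by rewrite expnSr mulKn.
have kapp : p.-primitive_root kap.
  have pdvd : (p %| p ^ m.+1)%N by rewrite expnS dvdn_mulr.
  by have := dvdn_prim_root thp pdvd; rewrite expnS mulKn.
have th0 : `|th| = 1 by apply: unity_root_norm thP; rewrite expn_gt0 p0.
have Hval (t1 : 'I_p) (t2 : 'I_P') : val t1 != 0%N ->
    `|\sum_(k < P') (th ^+ p) ^+ (t2 * k) *
      (th ^+ (t1 * k) * \sum_(a < p) kap ^+ (t1 * a) * (c k a)%:~R)| ^+ 2 = v.
  (* Residues prime to [p] modulo [p ^ m.+1] are [t1 + p * t2] with [t1] nonzero; on [kap] only [t1]
     matters. *)
  move=> t10; pose t := (t1 + p * t2)%N.
  have ct : coprime t (p ^ m.+1).
    rewrite coprimeXr // coprime_sym prime_coprime // /t dvdn_addl ?dvdn_mulr //.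
    by rewrite gtnNdvd ?lt0n.
  rewrite -(Hv (galois_aut (p ^ m.+1) t)); congr (`|_| ^+ 2).
  rewrite rmorph_sum; apply: eq_bigr => k _; rewrite !mulr_sumr rmorph_sum.
  apply: eq_bigr => a _; rewrite !rmorphM rmorph_int !rmorphXn /= galois_autE //.
  rewrite !mulrA; congr (_ * _).
  rewrite -!exprM -!exprD; apply: (exp_eq_mod thP).
  set A := (X in X = _ %[mod _]); set B := (X in _ = X %[mod _]).
  have -> : (B = t2 * a * (p ^ m.+1) + A)%N by rewrite /A /B /t expnS; nia.
  by rewrite modnMDl.
have : \sum_(t1 < p | val t1 != 0%N) \sum_(t2 < P') v =
   P'%:R * \sum_(k < P') \sum_(t1 < p | val t1 != 0%N)
     `|\sum_(a < p) kap ^+ (t1 * a) * (c k a)%:~R| ^+ 2.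
  rewrite [in RHS]exchange_big mulr_sumr /=; apply: eq_bigr => t1 t10.
  rewrite (eq_bigr _ (fun t2 _ => esym (Hval t1 t2 t10))).
  rewrite parseval //; congr (_ * _); apply: eq_bigr => k _.
  by rewrite normrM normrX th0 expr1n mul1r.
rewrite sumr_const sumr_const card_ord.
have -> : #|[pred t : 'I_p | val t != 0%N]| = p.-1.
  by rewrite -[in RHS](card_ord p) -(cardC1 (Ordinal p0)); apply: eq_card => t; rewrite !inE.
have P'neq0 : P'%:R != 0 :> algC by rewrite pnatr_eq0 -lt0n.
have -> : v *+ P' *+ p.-1 = P'%:R * ((p.-1)%:R * v) by rewrite !mulr_natl mulrnAC.
move=> /(mulfI P'neq0) EE.
rewrite -mulrA EE mulr_sumr rmorph_sum; apply: eq_bigr => k _.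
rewrite parseval_offdiag // rmorph_sum; apply: eq_bigr => a _.
rewrite rmorph_sum; apply: eq_bigr => b _.
by rewrite -intrB normCK conj_intr ?intr_int // -expr2 rmorphXn.
Qed.

End PrimePower.

(** * Counting roots of unity by classes *)

Lemma sq_ge_mul (e c : int) : `|e| <= 1 -> e * c <= c ^+ 2.
Proof.
move=> He; have [->|[->|->]] : e = -1 \/ e = 0 \/ e = 1 by lia.
all: nia.
Qed.

Lemma sum_sq_ge n (c : 'I_n -> int) : `|\sum_(a < n) c a| <= \sum_(a < n) c a ^+ 2.
Proof.
apply: le_trans (ler_norm_sum _ _ _) _; apply: ler_sum => a _; nia.
Qed.

Lemma sum_diff_sq n (c : 'I_n -> int) :
  \sum_(a < n) \sum_(b < n) (c a - c b) ^+ 2 =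
  2 * (n%:Z * (\sum_(a < n) c a ^+ 2) - (\sum_(a < n) c a) ^+ 2).
Proof.
under eq_bigr => a _.
  under eq_bigr => b _.
    have -> : (c a - c b) ^+ 2 = c a ^+ 2 + (- 2 * c a) * c b + c b ^+ 2 by ring.
    over.
  rewrite !big_split /= sumr_const card_ord -mulr_sumr.
  over.
rewrite !big_split /= sumr_const card_ord -mulr_suml -mulr_sumr.
rewrite sumrMnl -!(mulr_natl (\sum_(a < n) c a ^+ 2)) -[n%:R]/(n%:~R : int) intz.
ring.
Qed.

(** The square roots of 3 modulo 11 are 5 and -5. *)
Lemma sq_mod11 (s : int) : `|s| <= 4 -> (11 %| s ^+ 2 - 3)%Z -> False.
Proof.
move=> Hs.
have : s \in [:: -4; -3; -2; -1; 0; 1; 2; 3; 4].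
  by rewrite !inE; lia.
by rewrite !inE => /or4P[/eqP->|/eqP->|/eqP->|/or4P[/eqP->|/eqP->|/eqP->|/or3P[/eqP->|/eqP->|/eqP->]]].
Qed.

(** The function [c] equals [e] at five places and 0 at six, and [u] exceeds [v] by
    [11 * g + 15 * e] in total. A large [g] makes the sum of [u] exceed 11; a small one forces [v]
    to be positive at six places if [e = 1], at five if [e = -1]. *)
Lemma two_level_class (u v : 'I_11 -> nat) (c : 'I_11 -> int) (e g : int) :
    `|e| = 1 -> (forall a, c a ^+ 2 = e * c a) -> \sum_(a < 11) c a = 5 * e ->
    (forall a, (u a)%:Z - (v a)%:Z = g + 3 * c a) ->
  (\sum_(a < 11) u a <= 11)%N -> (\sum_(a < 11) v a <= 4)%N -> False.
Proof.
move=> He Hc sum_c Huv Hu Hv.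
have natz_sum (f : 'I_11 -> nat) : (\sum_(a < 11) f a)%N%:Z = \sum_(a < 11) (f a)%:Z.
  by rewrite -natz natr_sum; apply: eq_bigr => a _; rewrite natz.
have sum_cst (x : int) : \sum_(a < 11) x = 11 * x by rewrite sumr_const card_ord mulr_natl.
have sumd : \sum_(a < 11) ((u a)%:Z - (v a)%:Z) = 11 * g + 15 * e.
  under eq_bigr do rewrite Huv.
  by rewrite big_split /= sum_cst -mulr_sumr sum_c; ring.
rewrite sumrB -!natz_sum in sumd.
have [e1|e1] : e = 1 \/ e = -1 by lia.
- rewrite {}e1 in He Hc sum_c sumd.
  have [g0|g0] := leP 0 g; first by lia.
  suff : \sum_(a < 11) (1 - c a) <= (\sum_(a < 11) v a)%N%:Z.
    by rewrite sumrB sum_cst sum_c; lia.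
  rewrite natz_sum; apply: ler_sum => a _.
  have := Hc a; have := Huv a; nia.
- rewrite {}e1 in He Hc sum_c sumd.
  have [g0|g0] := leP 3 g; first by lia.
  suff : \sum_(a < 11) (- c a) <= (\sum_(a < 11) v a)%N%:Z.
    by rewrite sumrN sum_c; lia.
  rewrite natz_sum; apply: ler_sum => a _.
  have := Hc a; have := Huv a; nia.
Qed.

(** Here [c] holds the coefficients of a number of squared modulus 3, and 60 is [2 * 10 * 3] from
    [pcomb_trace]. Centring each class leaves the sum of [11 * S k - r k ^+ 2] equal to 30, and the
    residue modulo 11 then forces one class with five coefficients equal to a common sign and six
    equal to 0. *)
Lemma no_class_counts n (c : 'I_n -> 'I_11 -> int) (u v : 'I_n -> 'I_11 -> nat) :
    \sum_(k < n) \sum_(a < 11) \sum_(b < 11) (c k a - c k b) ^+ 2 = 60 ->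
    (11 %| (\sum_(k < n) \sum_(a < 11) c k a) ^+ 2 - 3)%Z ->
    (forall k a b, (u k a)%:Z - (v k a)%:Z - 3 * c k a = (u k b)%:Z - (v k b)%:Z - 3 * c k b) ->
    (\sum_(k < n) \sum_(a < 11) u k a <= 11)%N ->
    (\sum_(k < n) \sum_(a < 11) v k a <= 4)%N ->
  False.
Proof.
move=> Hq Hs Huv Hu Hv.
(* Rounding the class mean to the nearest integer brings the class sum [r k] into the range from -5
   to 5. *)
pose e k := ((\sum_(a < 11) c k a + 5) %/ 11)%Z.
pose d k a := c k a - e k; pose r k := \sum_(a < 11) d k a.
pose S k := \sum_(a < 11) d k a ^+ 2.
have sum_cst (x : int) : \sum_(a < 11) x = 11 * x by rewrite sumr_const card_ord mulr_natl.
have rE k : r k = \sum_(a < 11) c k a - 11 * e k by rewrite /r /d sumrB sum_cst.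
have r5 k : `|r k| <= 5.
  rewrite rE /e; have := divz_eq (\sum_(a < 11) c k a + 5) 11.
  have := modz_ge0 (\sum_(a < 11) c k a + 5) (isT : (11 : int) != 0).
  have := ltz_pmod (\sum_(a < 11) c k a + 5) (isT : (0 : int) < 11).
  lia.
have rS k : `|r k| <= S k by apply: sum_sq_ge.
have {}Hq : \sum_(k < n) (11 * S k - r k ^+ 2) = 30.
  apply: (@mulfI int 2) => //; rewrite mulr_sumr -[RHS]/(60 : int) -Hq.
  apply: eq_bigr => k _; rewrite -(sum_diff_sq (d k)).
  apply: eq_bigr => a _; apply: eq_bigr => b _.
  by rewrite /d; ring.
have q0 k : 0 <= 11 * S k - r k ^+ 2 by have := r5 k; have := rS k; nia.
have {}Hs : (11 %| (\sum_(k < n) r k) ^+ 2 - 3)%Z.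
  under eq_bigr do rewrite rE; rewrite sumrB -mulr_sumr.
  set x := \sum_(k < n) _ in Hs *; set y := \sum_(k < n) e k.
  have -> : (x - 11 * y) ^+ 2 - 3 = (x ^+ 2 - 3) + 11 * (11 * y ^+ 2 - 2 * x * y) by ring.
  by rewrite rpredD // dvdz_mulr.
(* If all [r k] are at most 4 in absolute value, each term is at least 7 times that value, so their
   sum is at most 4 in absolute value, against [sq_mod11]. *)
case: (pickP (fun k => 5 <= `|r k|)) => [k0 Hk0|small]; last first.
  apply: sq_mod11 Hs; apply: le_trans (ler_norm_sum _ _ _) _.
  suff : 7 * (\sum_(k < n) `|r k|) <= 30 by move: (\sum_(k < n) `|r k|) => ? ?; lia.
  rewrite -Hq mulr_sumr; apply: ler_sum => k _.
  have := rS k; have := small k; have := normr_ge0 (r k); nia.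
have rk0 : `|r k0| = 5 by have := r5 k0; lia.
(* A class with sum 5 or -5 already costs [11 * 5 - 25 = 30], the whole budget. *)
have Sk0 : S k0 = 5.
  have : 11 * S k0 - r k0 ^+ 2 <= 30.
    by rewrite -Hq (bigD1 k0) //= lerDl sumr_ge0.
  have := rS k0; nia.
pose eps : int := if 0 <= r k0 then 1 else -1.
have r_eps : r k0 = 5 * eps by rewrite /eps; case: ifP; lia.
have eps1 : `|eps| = 1 by rewrite /eps; case: ifP.
have Hd : forall a, d k0 a ^+ 2 = eps * d k0 a.
  have : \sum_(a < 11) (d k0 a ^+ 2 - eps * d k0 a) = 0.
    rewrite sumrB -mulr_sumr -/(S k0) -/(r k0) Sk0 r_eps.
    have eps2 : eps * eps = 1 by rewrite /eps; case: ifP.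
    by rewrite mulrCA eps2.
  move/psumr_eq0P => H a; apply/eqP; rewrite -subr_eq0; apply/eqP/H => // b _.
  by rewrite subr_ge0 sq_ge_mul ?eps1.
apply: (@two_level_class (u k0) (v k0) (d k0) eps
  ((u k0 ord0)%:Z - (v k0 ord0)%:Z - 3 * c k0 ord0 + 3 * e k0)) => //.
- by move=> a; have := Huv k0 a ord0; rewrite /d; lia.
- by apply: leq_trans Hu; rewrite (bigD1 k0) //= leq_addr.
- by apply: leq_trans Hv; rewrite (bigD1 k0) //= leq_addr.
Qed.

Lemma sq5_mod11 (s : int) : (11 %| s ^+ 2 - 27)%Z -> (11 %| s - 4)%Z \/ (11 %| s + 4)%Z.
Proof.
move=> H; have : (11 %| (s - 4) * (s + 4))%Z.
  have -> : (s - 4) * (s + 4) = (s ^+ 2 - 27) + 11 by ring.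
  by rewrite rpredD.
by rewrite dvdzE abszM Euclid_dvdM // => /orP[H1|H1]; [left | right].
Qed.

(** As 27 is 16 modulo 11, [N j] and the other counts differ by 4 or -4. The total 27 excludes the
    sign making the others 9 modulo 11, as they would sum to at least 36. So the others are 4 modulo
    11 and [N j] is 0: either [N j = 11] and the others are 4, or [N j = 0] and exactly one other is
    15. *)
Lemma five_counts (N : 'I_5 -> nat) j :
    (\sum_(i < 5) N i = 27)%N ->
    (forall i i', i != j -> i' != j -> (11 %| (N i)%:Z - (N i')%:Z)%Z) ->
    (forall i, i != j -> (11 %| ((N j)%:Z - (N i)%:Z) ^+ 2 - 27)%Z) ->
  (N j <= 11)%N /\ exists2 i, i != j & (N i <= 4)%N.
Proof.
move=> sumN HN Hsq; pose M i := N (lift j i).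
have lj i : lift j i != j by rewrite eq_sym neq_lift.
rewrite (bigD1_ord j) //= !big_ord_recl big_ord0 in sumN.
rewrite -!/(M _) in sumN.
have H01 := HN _ _ (lj (lift ord0 ord0)) (lj ord0).
have H02 := HN _ _ (lj (lift ord0 (lift ord0 ord0))) (lj ord0).
have H03 := HN _ _ (lj (lift ord0 (lift ord0 (lift ord0 ord0)))) (lj ord0).
have H0 := Hsq _ (lj ord0).
rewrite -!/(M _) in H01 H02 H03 H0.
have {}H0 := sq5_mod11 H0.
have [HNj HM] : (N j <= 11)%N /\ (M ord0 <= 4 \/ M (lift ord0 ord0) <= 4)%N.
  by case/dvdzP: H01 => x1; case/dvdzP: H02 => x2; case/dvdzP: H03 => x3;
     case: H0 => /dvdzP[x0]; lia.
split=> //; case: HM => HM; last by exists (lift j (lift ord0 ord0)).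
by exists (lift j ord0).
Qed.

(** * Nonexistence of the bent function *)

(** The order of 3 modulo 11 is 5. By Euler [b] squares to 1, and [b + 1] is invertible, so [b] is
    1. The base 121 keeps the exponent congruent to 1 modulo 4, as the congruence modulo 5
    requires. *)
Lemma exp3_mod_pow11 k : (3 ^ (5 * 121 ^ k.+1) = 1 %[mod 11 ^ k.+1])%N.
Proof.
pose b := (3 ^ (5 * 11 ^ k))%N.
have b11 : (b = 1 %[mod 11])%N by rewrite /b expnM -modnXm exp1n.
have b2 : (b ^ 2 = 1 %[mod 11 ^ k.+1])%N.
  have := @cyclic.Euler_exp_totient 3 (11 ^ k.+1).
  rewrite totient_pfactor // coprimeXr // => /(_ isT) <-.
  by rewrite -expnM /=; congr (3 ^ _ %% _)%N; lia.
have b1 : (b = 1 %[mod 11 ^ k.+1])%N.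
  have b0 : (0 < b)%N by rewrite expn_gt0.
  apply/eqP; rewrite eqn_mod_dvd //.
  rewrite -(@Gauss_dvdl _ _ (b + 1)); last first.
    by rewrite coprimeXl // prime_coprime // /dvdn -modnDml b11.
  have : (11 ^ k.+1 %| b ^ 2 - 1 ^ 2)%N by rewrite -eqn_mod_dvd ?expn_gt0 ?b0 //; apply/eqP.
  by rewrite subn_sqr.
have -> : (5 * 121 ^ k.+1 = (5 * 11 ^ k) * (11 * 11 ^ k.+1))%N.
  by rewrite -[121%N]/(11 * 11)%N expnMn !expnS; lia.
by rewrite expnM -/b -modnXm b1 modnXm exp1n.
Qed.

Lemma exp3_mod5 k : (3 ^ (5 * 121 ^ k) = 3 %[mod 5])%N.
Proof.
have E4 : ((5 * 121 ^ k) %% 4 = 1)%N by rewrite -modnMmr -modnXm exp1n.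
rewrite (divn_eq (5 * 121 ^ k) 4) E4 addn1 expnS mulnC [(_ * 4)%N]mulnC expnM.
by rewrite -modnMml -modnXm exp1n.
Qed.

Lemma fourier_inj (G : finZmodType) (F : G -> algC) :
  (forall i : Iirr [set: G], \sum_(x : G) F x * 'chi_i x = 0) -> forall y, F y = 0.
Proof.
move=> HF y; have abG : abelian [set: G] by apply: FinRing.zmod_abelian.
have : \sum_(i : Iirr [set: G]) (\sum_(x : G) F x * 'chi_i x) * ('chi_i y)^* = 0.
  by rewrite big1 // => i _; rewrite HF mul0r.
under eq_bigr do rewrite mulr_suml.
rewrite exchange_big (bigD1 y) //= [X in _ + X]big1 ?addr0 => [|x xy]; last first.
  under eq_bigr do rewrite -mulrA.
  rewrite -mulr_sumr second_orthogonality_relation ?inE //.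
  by rewrite (abelian_classP _ abG) ?inE // (negPf xy) mulr0n mulr0.
under eq_bigr do rewrite -mulrA.
rewrite -mulr_sumr second_orthogonality_relation ?inE // class_refl mulr1n => /eqP.
by rewrite mulf_eq0 pnatr_eq0 (negPf (lt0n_neq0 (cardG_gt0 _))) orbF => /eqP.
Qed.

(** With [r.+1] the order [P] is divisible by 11 even for [r = 0], so that cosets of the 11-th roots
    of unity exist. *)
Lemma no_bent_rooted (G : finZmodType) (r : nat) (g : G -> algC) :
    (forall x : G, x *+ 3 = 0) -> #|G| = 27%N ->
    (forall x, g x ^+ (5 * 11 ^ r.+1) = 1) ->
    (forall chi : 'CF([set: G]), chi \is a linear_char ->
       `|\sum_(x : G) g x * chi x| ^+ 2 = 27) ->
  False.
Proof.
move=> G3 cardG g_root bent.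
set P := (11 ^ r.+1)%N in g_root; set P' := (11 ^ r)%N.
have P0 : (0 < P)%N by rewrite expn_gt0.
have co15P : coprime 15 P by rewrite coprimeXr.
have co5P : coprime 5 P by rewrite coprimeXr.
have coP3 : coprime P 3 by rewrite coprimeXl.
have [w wp] := @C_prim_root_exists 3 isT; have [xi xip] := @C_prim_root_exists 5 isT.
have [th thp] := C_prim_root_exists P0.
have w3 := prim_expr_order wp; have xi5 := prim_expr_order xip.
have thP := prim_expr_order thp.
pose QP := exp3_mod_pow11 r; pose Q5 := exp3_mod5 r.+1.
set kap := th ^+ P'.
(* Coordinates of [g x]: the exponent of [xi], the coset of mu_11, the position in it. *)
have [coo Hcoo] : exists coo : G -> 'I_5 * 'I_P' * 'I_11,
    forall x, g x = xi ^+ (coo x).1.1 * (th ^+ (coo x).1.2 * kap ^+ (coo x).2).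
  apply: (fin_all_exists (P := fun x (t : 'I_5 * 'I_P' * 'I_11) =>
    g x = xi ^+ t.1.1 * (th ^+ t.1.2 * kap ^+ t.2))) => x.
  have [y [z [y5 zP ->]]] := unity_root_split co5P isT P0 (g_root x).
  have [i ->] := prim_rootP xip y5.
  have [k [a ->]] := root_kap (isT : prime 11) thp zP.
  by exists (i, k, a).
pose ix x := (coo x).1.1; pose rt x := th ^+ (coo x).1.2 * kap ^+ (coo x).2.
have rtP x : rt x ^+ P = 1.
  have kapP : kap ^+ P = 1 by rewrite exprAC thP expr1n.
  by rewrite exprMn exprAC thP expr1n mul1r exprAC kapP expr1n.
pose H (chi : 'CF([set: G])) (i : 'I_5) : algC := \sum_(x | ix x == i) rt x * chi x.
have sumH (chi : 'CF([set: G])) : \sum_(x : G) g x * chi x = \sum_(i < 5) xi ^+ i * H chi i.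
  rewrite (partition_big ix xpredT) //=; apply: eq_bigr => i _.
  rewrite mulr_sumr; apply: eq_bigr => x /eqP <-.
  by rewrite Hcoo -/(rt x) mulrA.
have chi3 (chi : 'CF([set: G])) x : chi \is a linear_char -> chi x ^+ 3 = 1.
  by move=> lc; rewrite -lin_charX ?inE // FinRing.zmodXgE G3 -FinRing.zmod1gE lin_char1.
have rt3P x : cycint (3 * P) (rt x) by apply: cycint_root; rewrite mulnC exprM rtP expr1n.
have H_cyc (chi : 'CF([set: G])) i : chi \is a linear_char -> cycint (3 * P) (H chi i).
  move=> lc; apply: cycint_sum => x _; apply: cycintM => //.
  by apply: cycint_root; rewrite exprM chi3 // expr1n.
have Hconst (chi : 'CF([set: G])) : chi \is a linear_char ->
    exists c, forall i j, i != c -> j != c -> H chi i = H chi j.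
  move=> lc; apply: (almost_constant P0 co15P QP Q5 wp xip) => [i|]; first exact: H_cyc.
  by rewrite -sumH bent.
have lin_irr i : 'chi[[set: G]]_i \is a linear_char.
  by apply/char_abelianP; apply: FinRing.zmod_abelian.
have third (i j : 'I_5) : exists2 l, l != i & l != j.
  have : (0 < #|[set~ i] :\ j|)%N.
    by have := cardsD1 j [set~ i]; rewrite cardsC1 card_ord; case: (_ \in _); lia.
  by move=> /card_gt0P[l]; rewrite !inE => /andP[lj li]; exists l.
pose cst (j : 'I_5) (chi : 'CF([set: G])) :=
  [forall i, forall i', (i != j) ==> (i' != j) ==> (H chi i == H chi i')].
have cstP j chi : reflect (forall i i', i != j -> i' != j -> H chi i = H chi i') (cst j chi).
  apply: (iffP forallP) => [K i i' ij i'j|K i].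
    by have /forallP/(_ i') := K i; rewrite ij i'j /= => /eqP.
  by apply/forallP => i'; apply/implyP => ij; apply/implyP => i'j; rewrite (K i i').
have p11 : prime 11 by [].
have rt_augm x : augm 11 r.+1 (rt x) 1 by apply: augm_root.
have [j /cstP Hj] := Hconst _ (lin_irr 0).
(* Either the exceptional index [j] of the trivial character serves all characters, or some
   character has a different one. *)
have [/forallP allj|] := boolP [forall l : Iirr [set: G], cst j 'chi_l].
  have all_ix x : ix x = j.
    apply/eqP/contraT => xj; have [l lx lj] := third (ix x) j.
    (* All characters vanish on the difference of the parts at [ix x] and [l], neither of which is
       [j]; so [F] is 0, although its value at [x] is a root of unity. *)
    pose F y := rt y * ((ix y == ix x)%:R - (ix y == l)%:R).
    have /(_ x) : forall y, F y = 0.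
      apply: fourier_inj => i.
      transitivity (H 'chi_i (ix x) - H 'chi_i l); last first.
        by rewrite (cstP _ _ (allj i) _ l) // subrr.
      rewrite /H (big_mkcond (fun y => ix y == ix x)) (big_mkcond (fun y => ix y == l)) -sumrB.
      apply: eq_bigr => y _; rewrite /F.
      by case: eqP => _; case: eqP => _ /=; ring.
    rewrite /F eqxx eq_sym (negPf lx) subr0 mulr1 => rt0.
    by have := unity_root_neq0 P0 (rtP x); rewrite rt0 eqxx.
  pose A := \sum_(x : G) rt x.
  have A27 : `|A| ^+ 2 = 27.
    have := bent 1 (cfun1_lin_char _).
    have -> : \sum_(x : G) g x * (1 : 'CF([set: G])) x = xi ^+ j * A.
      rewrite mulr_sumr; apply: eq_bigr => x _.
      by rewrite cfun1E inE mulr1 Hcoo -/(ix x) all_ix.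
    by rewrite normrM normrX (unity_root_norm _ xi5) // expr1n mul1r.
  have augA : augm 11 r.+1 A 27.
    suff : augm 11 r.+1 A (\sum_(x : G) 1) by rewrite sumr_const cardG.
    exact: augm_sum.
  have := augmM augA (augm_conj p11 augA); rewrite -normCK A27 => aug27.
  by have := augm_inj p11 aug27 (augm_int r.+1 27 p11 isT).
rewrite negb_forall => /existsP[l Hl].
have [jl Hjl] := Hconst _ (lin_irr l).
have jjl : j != jl by apply: contraNneq Hl => ->; apply/cstP.
have [i1 i1j i1jl] := third j jl.
pose A i := \sum_(x | ix x == i) rt x.
have HA i : H 'chi_0 i = A i.
  by apply: eq_bigr => x _; rewrite irr0 cfun1E inE mulr1.
have Hj' i : i != j -> A i = A i1 by move=> ij; rewrite -!HA; apply: (cstP _ _ Hj).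
have lam_dvd i : cycdvd (3 * P) (1 - w) (H 'chi_l i - A i).
  rewrite -sumrB; apply: big_ind => [||x _]; [exact: cycdvd0 | exact: cycdvdD |].
  have -> : rt x * 'chi_l x - rt x = rt x * ('chi_l x - 1) by ring.
  apply: cycdvdMl => //.
  by apply: lam_dvd_root3 => //; [rewrite dvdn_mulr | apply: chi3].
have A_cyc i : cycint P (A i) by apply: cycint_sum => x _; apply: cycint_root.
(* The indices [j] and [i1] both avoid [jl], so the values of ['chi_l] there agree, and modulo
   [1 - w] they are [A j] and [A i1]. *)
have [b Hb Eb] : exists2 b, cycint P b & A j - A i1 = 3 * b.
  have [e He Ee] := cycdvdB (lam_dvd i1) (lam_dvd j).
  apply: (dvd3_of_lam P0 coP3 wp) He _; first exact: cycintB.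
  by rewrite -Ee (Hjl j i1) //; ring.
have A27 : `|A j - A i1| ^+ 2 = 27.
  have := bent 'chi_0 (lin_irr 0); rewrite sumH.
  rewrite (xi_sum_almost_constant xip (c := j) (t := A i1)) => [|i ij]; last by rewrite HA Hj'.
  by rewrite normrM normrX (unity_root_norm _ xi5) // expr1n mul1r HA.
have b3 : `|b| ^+ 2 = 3.
  apply: (@mulfI _ 9); first by rewrite pnatr_eq0.
  move: A27; rewrite Eb normrM exprMn normr_nat => E27.
  by transitivity (27 : algC); [rewrite -E27; ring | ring].
pose Nx i := #|[pred x | ix x == i]|.
have A_augm i : augm 11 r.+1 (A i) (Nx i).
  have -> : (Nx i)%:Z = \sum_(x | ix x == i) 1 by rewrite sumr_const natz.
  exact: augm_sum.
have [Nj [i2 i2j Ni2]] : (Nx j <= 11)%N /\ exists2 i, i != j & (Nx i <= 4)%N.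
  apply: five_counts => [|i i' ij i'j|i ij].
  - rewrite -cardG -sum1_card (partition_big ix xpredT) //=.
    by apply: eq_bigr => i _; rewrite sum1_card.
  - apply: (augm_inj p11 (A_augm i)); rewrite (Hj' i) // -(Hj' i') //.
  - have B := augmB p11 isT (A_augm j) (A_augm i).
    have := augmM B (augm_conj p11 B); rewrite -normCK (Hj' i) // A27 => aug27.
    exact: (augm_inj p11 aug27 (augm_int r.+1 27 p11 isT)).
have [c Ec] := cycint_pcomb p11 thp Hb.
(* The multiplicity of each root of unity in [A i], giving its coefficients in [pcomb]. *)
pose cnt i (k : 'I_P') (a : 'I_11) :=
  (\sum_(x | ix x == i) ((k == (coo x).1.2) && (a == (coo x).2)))%N.
have sum_cnt i : (\sum_(k < P') \sum_(a < 11) cnt i k a = Nx i)%N.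
  rewrite /Nx -sum1_card /cnt.
  under [LHS]eq_bigr do rewrite exchange_big /=.
  rewrite [LHS]exchange_big /=; apply: eq_bigr => x _.
  rewrite (bigD1 (coo x).1.2) //= [X in (_ + X)%N]big1 ?addn0 => [|k /negPf->]; last by rewrite big1.
  rewrite (bigD1 (coo x).2) //= [X in (_ + X)%N]big1 ?addn0 => [|a /negPf->]; last by rewrite andbF.
  by rewrite !eqxx.
have A_pcomb i : A i = pcomb th (fun k a => (cnt i k a)%:Z).
  transitivity (pcomb th (fun k a => \sum_(x | ix x == i)
     ((k == (coo x).1.2) && (a == (coo x).2))%:Z)).
    by rewrite pcomb_sum; apply: eq_bigr => x _; rewrite pcomb_delta.
  apply: eq_bigr => k _; apply: eq_bigr => a _; congr (_ * _%:~R).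
  by rewrite -natz natr_sum; apply: eq_bigr => x _; rewrite natz.
apply: (@no_class_counts P' c (cnt j) (cnt i2)).
- apply: (@intr_inj algC); rewrite (pcomb_trace p11 thp (v := 3)); first by rewrite -!natrM.
  by move=> u; rewrite -Ec (cycint_normC_rmorph u P0 Hb) b3 rmorph_nat.
- have augb := pcomb_augm p11 thp c isT; rewrite -Ec in augb.
  have := augmM augb (augm_conj p11 augb); rewrite -normCK b3 => aug3.
  exact: (augm_inj p11 aug3 (augm_int r.+1 3 p11 isT)).
(* These are coefficients of [A j - A i2 - 3 * b = 0]; the trace form vanishes, so they are constant
   on each coset. *)
- pose d k a := (cnt j k a)%:Z + -1 * (cnt i2 k a)%:Z + -3 * c k a.
  have d0 : pcomb th d = 0.
    by rewrite !pcombD !pcombM -!A_pcomb -Ec (Hj' i2) // -[A j](subrK (A i1)) Eb; ring.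
  have d_trace (u : {rmorphism algC -> algC}) : `|u (pcomb th d)| ^+ 2 = 0.
    by rewrite d0 rmorph0 normr0 expr0n.
  have := pcomb_trace p11 thp d_trace; rewrite mulr0 => /eqP; rewrite intr_eq0 => /eqP.
  move/psumr_eq0P => K k a a'.
  have {}K := K (fun k _ => sumr_ge0 _ (fun a _ => sumr_ge0 _ (fun b _ => sqr_ge0 _))) k isT.
  move/psumr_eq0P: K => /(_ (fun a _ => sumr_ge0 _ (fun b _ => sqr_ge0 _)) a isT).
  move/psumr_eq0P => /(_ (fun b _ => sqr_ge0 _) a' isT) /eqP.
  rewrite sqrf_eq0 subr_eq0 => /eqP Ed.
  by transitivity (d k a); [rewrite /d; ring | rewrite Ed /d; ring].
- by rewrite sum_cnt.
- by rewrite sum_cnt.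
Qed.

Theorem corollary3p9 (r : nat) (zeta : algC)
    (zeta_prim : (5 * 11 ^ r)%N.-primitive_root zeta) :
  ~ exists f : 'rV['Z_3]_3 -> 'Z_(5 * 11 ^ r), generalized_bent zeta f.
Proof.
case=> f; rewrite /generalized_bent card_mx card_ord.
apply: (@no_bent_rooted _ r) => [x||x].
- apply/matrixP => i j; rewrite mulmxnE !mxE.
  by case: (x i j) => [[|[|[|]]] ?] //; apply/val_inj.
- by rewrite card_mx card_ord.
(* Powers of [zeta] are roots of unity of order dividing [5 * 11 ^ r], hence also
   [5 * 11 ^ r.+1]. *)
- rewrite expnS mulnCA exprAC [(11 * _)%N]mulnC exprM.
  by rewrite (prim_expr_order zeta_prim) !expr1n.
Qed.
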